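(* For each $d\ge2$ there exists $c_d>0$ such that the following holds. If $\mathbb{D}_0\ni0$ is a finite connected domain in $\mathbb{Z}^d$ and the closed Euclidean unit ball $\mathbb{B}$ centered at the origin is a $c_d$-almost regular shape for the growing domains $\{\mathbb{D}_t\}$, then $0$ is a.s. recurrent for the sample path of any simple random walk $\{R_t\}$ of remotely open by touch (ROBT) interaction with $\{\mathbb{D}_t\}$.
   Context: Setting: $\{\mathbb{D}_t\}_{t\ge0}$ is a (possibly random) non-decreasing sequence of connected subgraphs (domains) of $\mathbb{Z}^d$. The simple random walk $\{R_t\}$ on $\{\mathbb{D}_t\}$ starts at $R_0=0$, is adapted to a filtration $\{\mathcal{F}_t\}$, and $\{\mathbb{D}_t\}$ is $\mathcal{F}_\cdot$-previsible; given $\mathcal{F}_t$, $R_{t+1}$ is chosen uniformly among all neighbors of $R_t$ within $\mathbb{D}_t$. Standing assumption: $\mathbb{D}_0$ contains $0$, its nearest neighbors and all $2d$ edges of $\mathbb{Z}^d$ at $0$. The boundary is $\partial\mathbb{D}_t:=\{z\in\mathbb{D}_t:\deg_{\mathbb{D}_t}(z)<2d\}$. Remotely open by touch (ROBT) interaction: $\mathbb{D}_{t+1}=\mathbb{D}_t$ except when $R_t\in\partial\mathbb{D}_t$, and the collection of edges added to $\mathbb{D}_t$ at such times is only required to be of uniformly bounded cardinality (not necessarily near $R_t$). Almost regular shape: $\mathbb{K}\subset\mathbb{R}^d$ is a $\gamma$-almost regular shape for growing domains $\{\mathbb{D}_t\}$ in $\mathbb{Z}^d$ if (almost surely) there is some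 non-decreasing $f(\cdot)\ge1$ such that, for all $t$ large, $\mathbb{D}_t\supseteq f(t)\mathbb{K}\cap\mathbb{Z}^d$ (as the subgraph of $\mathbb{Z}^d$ induced on these points) and $d^{\mathbb{D}_t}(z,f(t)\mathbb{K})\le\gamma\log f(t)$ for all $z\in\mathbb{D}_t$, where $d^{\mathbb{D}_t}(z,f(t)\mathbb{K})$ is the graph distance in $\mathbb{D}_t$ from $z$ to $f(t)\mathbb{K}\cap\mathbb{Z}^d$. The site $0$ is recurrent for the sample path if $R_t=0$ for infinitely many $t$. *)

(* Defs.v *)
From HB Require Import structures.
From mathcomp Require Import all_boot all_order all_algebra finmap.
From mathcomp Require Import all_classical all_reals all_analysis.

Set Implicit Arguments.
Unset Strict Implicit.
Unset Printing Implicit Defensive.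

Import Order.TTheory GRing.Theory Num.Theory.

Local Open Scope classical_set_scope.
Local Open Scope ring_scope.

Notation site d := 'rV[int]_d.

Definition zd_adj d (x y : site d) : bool :=
  \sum_(i < d) `|x 0 i - y 0 i| == 1.

(* Subgraphs of Z^d, not necessarily induced: an edge of Z^d between two
   vertices of the graph may be absent. *)
Record zgraph (d : nat) := ZGraph {
  vert : pred (site d);
  edge : rel (site d);
  edge_sym : forall x y, edge x y -> edge y x;
  edge_vert : forall x y, edge x y -> vert x;
  edge_zd_adj : forall x y, edge x y -> zd_adj x y }.

Section graphs.
Variable d : nat.
Implicit Types (G H : zgraph d) (A : set (site d)).

Definition subgraph G H : Prop :=
  (forall x, vert G x -> vert H x) /\ (forall x y, edge G x y -> edge H x y).

Definition connected_graph G : Prop :=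
  forall x y, vert G x -> vert G y -> exists2 p, path (edge G) x p & last x p = y.

Definition degree G (x : site d) : nat := #|` fset_set [set y | edge G x y] |.

Definition bdry G : set (site d) :=
  [set x | vert G x /\ (degree G x < 2 * d)%N].

(* Undirected edges, as two-element sets of sites. *)
Definition edges G : set (set (site d)) :=
  [set e | exists x y, edge G x y /\ e = [set x; y]].

Lemma zd_adj_sym (x y : site d) : zd_adj x y = zd_adj y x.
Proof. by rewrite /zd_adj; under eq_bigr do rewrite distrC. Qed.

Section induced.
Variable A : set (site d).

Let ivert : pred (site d) := fun x => x \in A.
Let iedge : rel (site d) := fun x y => [&& x \in A, y \in A & zd_adj x y].

Let iedge_sym x y : iedge x y -> iedge y x.
Proof. by case/and3P => xA yA xy; apply/and3P; split; rewrite // zd_adj_sym. Qed.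

Let iedge_vert x y : iedge x y -> ivert x.
Proof. by case/and3P. Qed.

Let iedge_zd_adj x y : iedge x y -> zd_adj x y.
Proof. by case/and3P. Qed.

Definition induced_graph : zgraph d := ZGraph iedge_sym iedge_vert iedge_zd_adj.
End induced.

(* Graph distance in G from z to A; it is +oo when A is not reachable. *)
Definition graph_dist (R : realType) G (z : site d) A : \bar R :=
  ereal_inf [set ((size p)%:R)%:E | p in
    [set p | path (edge G) z p /\ A (last z p)]].

End graphs.

(* The library norm on 'rV[R]_d is the sup norm. *)
Definition enorm (R : realType) d (x : 'rV[R]_d) : R :=
  Num.sqrt (\sum_(i < d) x 0 i ^+ 2).

Definition unit_eball (R : realType) d : set 'rV[R]_d := [set x | enorm x <= 1].

Definition lattice_points (R : realType) d (r : R) (K : set 'rV[R]_d) :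
    set (site d) :=
  [set z | [set r *: x | x in K] (map_mx intr z)].

Section processes.
Context (R : realType) (disp : measure_display) (T : measurableType disp).
Variable P : probability T R.

Record filtration (F : nat -> set_system T) : Prop := {
  filtration_sigma : forall t, sigma_algebra setT (F t);
  filtration_meas : forall t A, F t A -> measurable A;
  filtration_mono : forall s t, (s <= t)%N -> F s `<=` F t }.

(* Y is a version of P(A | F), for F a sub-sigma-algebra. *)
Record is_cond_prob (F : set_system T) (A : set T) (Y : T -> R) : Prop := {
  cond_prob_meas : forall B : set R, measurable B -> F (Y @^-1` B);
  cond_prob_integrable : P.-integrable setT (EFin \o Y);
  cond_probE : forall B, F B -> (\int[P]_(w in B) (Y w)%:E = P (A `&` B))%E }.

Section domains.
Variable d : nat.
Implicit Types (F : nat -> set_system T) (D : nat -> T -> zgraph d)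
  (W : nat -> T -> site d).

Definition growing_domains D : Prop :=
  {ae P, forall w, forall t,
    connected_graph (D t w) /\ subgraph (D t w) (D t.+1 w)}.

Definition contains_star0 (G : zgraph d) : Prop :=
  vert G 0 /\ forall y, zd_adj 0 y -> vert G y /\ edge G 0 y.

Definition graph_measurable (F : set_system T) (G : T -> zgraph d) : Prop :=
  (forall x, F [set w | vert (G w) x]) /\
  (forall x y, F [set w | edge (G w) x y]).

Definition previsible F D : Prop :=
  graph_measurable (F 0%N) (D 0%N) /\
  forall t, graph_measurable (F t) (D t.+1).

Definition adapted F W : Prop := forall t x, F t [set w | W t w = x].

Record simple_random_walk F D W : Prop := {
  srw_adapted : adapted F W;
  srw_previsible : previsible F D;
  srw_start : {ae P, forall w, W 0%N w = 0};
  srw_step : forall t y, is_cond_prob (F t) [set w | W t.+1 w = y]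
    (fun w => (edge (D t w) (W t w) y)%:R / (degree (D t w) (W t w))%:R) }.

(* The bound on the number of added edges is deterministic. *)
Definition robt D W : Prop :=
  exists M : nat, {ae P, forall w, forall t,
    (~ bdry (D t w) (W t w) -> D t.+1 w = D t w) /\
    (edges (D t.+1 w) `\` edges (D t w) #<= `I_M)%card}.

Definition almost_regular_shape (gamma : R) (K : set 'rV[R]_d) D : Prop :=
  {ae P, forall w, exists f : nat -> R,
    [/\ {homo f : s t / (s <= t)%N >-> s <= t},
        forall t, 1 <= f t &
        \forall t \near \oo,
          subgraph (induced_graph (lattice_points (f t) K)) (D t w) /\
          forall z, vert (D t w) z ->
            (graph_dist R (D t w) z (lattice_points (f t) K)
              <= (gamma * ln (f t))%:E)%E]}.

Definition recurrent (x : site d) (path : nat -> site d) : Prop :=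
  infinite_set [set t | path t = x].

End domains.
End processes.

(* Main.v *)
Require Import Defs.
From HB Require Import structures.
From mathcomp Require Import all_boot all_order all_algebra finmap.
From mathcomp Require Import all_classical all_reals all_analysis.
From mathcomp Require Import measurable_realfun ring lra zify.

(* Let [r] be the radius of the largest centred ball contained in the domain.
   On states (domain, position) consider the maximum of three functions: a
   power [|x| ^ (- 2 b)] with [2 b = d - 3/2], cut off so that it vanishes on
   the sphere of radius [r - 1] (it is subharmonic away from the origin); a
   layer [A(r) (4 d) ^ (- dist (x, ball of radius r - 2))], with [A(r)] of
   order [r ^ (- d + 1/2)]; and a multiple of [(4 d) ^ (- dist (x, 0))].  A
   weight [(4 d) ^ (- dist)] at least doubles on average in one step off its
   target, as some neighbour is closer and has weight [4 d] times larger.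
   Hence, while the walk is away from [0], the expectation of this maximum
   never decreases, and it gains the value of the layer at each visit of the
   boundary.  The maximum minus [A(r)] increases with the domain, so domain
   growth costs only the bounded telescoping quantity [A(r)].  Adding a further
   copy of [(4 d) ^ (- dist (x, 0))], one gets that on the event of no further
   visit to [0] the total gain is almost surely finite.  When the domain is
   almost a ball, the gain at a boundary visit is at least of order
   [r ^ (- d)], i.e. of the inverse of the number of edges, and the number of
   edges grows by a bounded amount only at boundary visits; so a finite total
   gain bounds the number of edges, hence the distance from the walk to [0],
   and then the gains do not even tend to [0]. *)

Set Implicit Arguments.
Unset Strict Implicit.
Unset Printing Implicit Defensive.

Import Order.TTheory GRing.Theory Num.Theory.
Import numFieldNormedType.Exports.

Local Open Scope classical_set_scope.
Local Open Scope ring_scope.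

(** * Subharmonic powers *)

Section power_function.
Context {R : realType}.
Implicit Types (b s x y u v : R).

Lemma ge0_derive_le (f df : R -> R) y : 0 <= y ->
  (forall x, 0 <= x <= y -> is_derive x 1 f (df x)) ->
  (forall x, 0 <= x <= y -> 0 <= df x) -> f 0 <= f y.
Proof.
move=> y0 fdf df0.
have [||c] := @MVT_segment R f df 0 y y0.
- by move=> x xy; apply: fdf; rewrite !(itvP xy).
- apply: continuous_in_subspaceT => z; rewrite inE/= => zy.
  apply/differentiable_continuous/derivable1_diffP.
  by have /fdf[] : 0 <= z <= y by rewrite !(itvP zy).
- move=> cy /eqP; rewrite subr0 subr_eq => /eqP ->.
  by rewrite lerDr mulr_ge0 // df0 // !(itvP cy).
Qed.

Lemma expR_sub_ge v : 0 <= v -> 2 * v <= expR v - expR (- v).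
Proof.
move=> v0.
have := @ge0_derive_le (fun x => expR x - expR (- x) - 2 * x)
  (fun x => expR x + expR (- x) - 2) v v0.
rewrite oppr0 subrr mulr0 subr0 subr_ge0; apply => x /andP[x0 _].
  apply: is_derive_eq; rewrite /GRing.scale/=; lra.
have e0 := expR_gt0 x; have e1 := expRxMexpNx_1 x.
have e2 := sqr_ge0 (expR x - 1); nra.
Qed.

(** With [v = u / 2], the right-hand side minus [2] is the square of [expR v - expR (- v)], which is
    at least [2 v = u] when [u >= 0]. *)
Lemma expR_add_ge u : 2 + u ^+ 2 <= expR u + expR (- u).
Proof.
wlog u0 : u / 0 <= u.
  move=> h; have [|/ltW u0] := leP 0 u; first exact: h.
  by have := h (- u); rewrite opprK sqrrN addrC (addrC (expR u)); apply; lra.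
have := @expR_sub_ge (u / 2); have := expRxMexpNx_1 (u / 2).
have -> : expR u = expR (u / 2) ^+ 2 by rewrite -expRM_natl; congr expR; field.
have -> : expR (- u) = expR (- (u / 2)) ^+ 2.
  by rewrite -expRM_natl; congr expR; field.
move=> e1 /(_ ltac:(lra)) e2; nra.
Qed.

Lemma ln_sub_ge y : 0 <= y < 1 -> 2 * y <= ln (1 + y) - ln (1 - y).
Proof.
case/andP => y0 y1.
have := @ge0_derive_le (fun x => ln (1 + x) - ln (1 - x) - 2 * x)
  (fun x => (1 + x)^-1 + (1 - x)^-1 - 2) y y0.
rewrite !addr0 subr0 ln1 mulr0 !subr0 subr_ge0; apply => x /andP[x0 xy].
  have x1 : 0 < 1 + x by lra.
  have x2 : 0 < 1 - x by lra.
  have h1 : is_derive (1 + x) 1 (@ln R) (1 + x)^-1 by exact: is_derive1_ln.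
  have h2 : is_derive (1 - x) 1 (@ln R) (1 - x)^-1 by exact: is_derive1_ln.
  by apply: is_derive_eq; rewrite /GRing.scale/=; lra.
have x1 : 0 < 1 + x by lra.
have x2 : 0 < 1 - x by lra.
have -> : (1 + x)^-1 + (1 - x)^-1 - 2 = 2 * x ^+ 2 / ((1 + x) * (1 - x)).
  by field; rewrite !gt_eqF.
by apply: divr_ge0; apply: mulr_ge0; rewrite ?sqr_ge0 // ltW.
Qed.

(* [s ^ (- b)] for [s > 0]; unlike [powR] it takes the value [1] at [s = 0],
   so that it is nonincreasing on the natural numbers. *)
Definition npow b s : R := expR (- (b * ln s)).

Lemma npow_gt0 b s : 0 < npow b s. Proof. exact: expR_gt0. Qed.

Lemma npow0 b : npow b 0 = 1.
Proof. by rewrite /npow ln0 // mulr0 oppr0 expR0. Qed.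

Lemma npowM b s x : 0 < s -> 0 < x -> npow b (s * x) = npow b s * npow b x.
Proof. by move=> s0 x0; rewrite /npow lnM // mulrDr opprD expRD. Qed.

Lemma npowD b c s : npow (b + c) s = npow b s * npow c s.
Proof. by rewrite /npow mulrDl opprD expRD. Qed.

Lemma npow_nat (n : nat) s : 0 < s -> npow n%:R s = (s ^+ n)^-1.
Proof. by move=> s0; rewrite /npow expRN expRM_natl lnK. Qed.

Lemma npow_sqr b s : 0 < s -> npow b (s ^+ 2) = npow (2 * b) s.
Proof.
by move=> s0; rewrite /npow lnXn //; congr expR; rewrite -mulr_natr; ring.
Qed.

Lemma npow_nincr b (m n : nat) : 0 <= b -> (m <= n)%N ->
  npow b n%:R <= npow b m%:R.
Proof.
move=> b0 mn; case: m mn => [|m] mn.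
  rewrite npow0 /npow -[leRHS]expR0 ler_expR oppr_le0 mulr_ge0 //.
  by case: n {mn} => [|n]; [rewrite ln0|rewrite ln_ge0 // ler1n].
rewrite /npow ler_expR lerN2 ler_wpM2l // ler_ln ?ler_nat ?posrE ?ltr0n //.
by rewrite (leq_trans _ mn).
Qed.

Lemma npow_le1 b (n : nat) : 0 <= b -> npow b n%:R <= 1.
Proof. by move=> b0; have := npow_nincr b0 (leq0n n); rewrite mulr0n npow0. Qed.

(* Write the left-hand side as [(1 - y^2) ^ (- b / 2)] times the hyperbolic
   cosine of [(b / 2) ln ((1 + y) / (1 - y)) >= b y]. *)
Lemma npow_sym_ge b y : 0 < b -> `|y| < 1 ->
  2 + (b + b ^+ 2) * y ^+ 2 <= npow b (1 + y) + npow b (1 - y).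
Proof.
move=> b0; wlog y0 : y / 0 <= y.
  move=> h y1; have [|/ltW y0] := leP 0 y; first by move/h; exact.
  by have := h (- y); rewrite opprK sqrrN normrN addrC (addrC (npow b _)); apply; lra.
rewrite ger0_norm // => y1.
set u := b / 2 * (ln (1 + y) - ln (1 - y)).
set v := - (b / 2 * (ln (1 + y) + ln (1 - y))).
have uy : b * y <= u.
  have := @ln_sub_ge y; rewrite y0 y1 => /(_ isT); rewrite /u; nra.
have vy : b / 2 * y ^+ 2 <= v.
  rewrite /v -lnM ?posrE; [|lra|lra].
  have -> : (1 + y) * (1 - y) = 1 + - y ^+ 2 by ring.
  have := @le_ln1Dx R (- y ^+ 2); have : y ^+ 2 < 1 by nra.
  move=> h /(_ ltac:(lra)); nra.
have -> : npow b (1 + y) = expR v * expR (- u).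
  by rewrite -expRD; congr expR; rewrite /u /v; field.
have -> : npow b (1 - y) = expR v * expR u.
  by rewrite -expRD; congr expR; rewrite /u /v; field.
rewrite -mulrDr addrC.
have h1 := expR_add_ge u; have h2 := expR_ge1Dx v.
have hu : (b * y) ^+ 2 <= u ^+ 2 by rewrite lerXn2r ?nnegrE //; nra.
apply: (@le_trans _ _ ((1 + b / 2 * y ^+ 2) * (2 + (b * y) ^+ 2))).
  have := sqr_ge0 (b * y ^+ 2); have := sqr_ge0 y; nra.
rewrite ler_pM //.
- by have := sqr_ge0 y; nra.
- by have := sqr_ge0 (b * y); nra.
- lra.
- by rewrite (addrC (expR _)); lra.
Qed.

(** Since [1 - 1 / x] is the inverse of [1 + 1 / (x - 1)], the power is at most
    [expR (b / (x - 1))], hence at most [(1 - b / (x - 1))^-1]. *)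
Lemma npow_pred_le b x : 0 < b -> 1 + b < x ->
  npow b (1 - x^-1) <= 1 + b / (x - 1 - b).
Proof.
move=> b0 bx; have x0 : 0 < x by lra.
have x1 : 0 < x - 1 by lra.
have -> : 1 - x^-1 = (1 + (x - 1)^-1)^-1 by field; rewrite !gt_eqF //; lra.
rewrite /npow lnV ?posrE; last by rewrite addr_gt0 // invr_gt0.
rewrite mulrN opprK.
have h : b * ln (1 + (x - 1)^-1) <= b / (x - 1).
  rewrite ler_pM2l // le_ln1Dx // (@lt_trans _ _ 0) // ?invr_gt0 //; lra.
apply: (@le_trans _ _ (expR (b / (x - 1)))); first by rewrite ler_expR.
have h2 := expR_ge1Dx (- (b / (x - 1))).
have h3 : 0 < 1 - b / (x - 1) by rewrite subr_gt0 ltr_pdivrMr //; lra.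
have -> : 1 + b / (x - 1 - b) = (1 - b / (x - 1))^-1.
  by field; rewrite !gt_eqF //; lra.
rewrite -[expR _]invrK lef_pV2 ?posrE ?invr_gt0 ?expR_gt0 //.
by rewrite -expRN.
Qed.

Lemma npow_pred_ge b x : 0 < b -> 1 < x -> 1 + b / x <= npow b (1 - x^-1).
Proof.
move=> b0 x1; rewrite /npow.
have h : ln (1 - x^-1) <= - x^-1.
  by apply: le_ln1Dx; rewrite ltrN2 invf_lt1 //; lra.
by apply: le_trans (expR_ge1Dx _); rewrite lerD2l -mulrN ler_wpM2l //; lra.
Qed.

(* Subharmonicity of [|x| ^ (- 2 b)] away from the origin in dimension [d]:
   the neighbours of [x] have squared norms [s + 1 + 2 z_i] and
   [s + 1 - 2 z_i], where [s = |x|^2]. *)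
Lemma npow_subharmonic (d : nat) b (z : 'I_d -> R) : (2 <= d)%N ->
  b = d%:R / 2 - 3 / 4 ->
  let s := \sum_(i < d) z i ^+ 2 in 10 * d%:R ^+ 2 <= s ->
  2 * d%:R * npow b s <=
    \sum_(i < d) (npow b (s + 1 + 2 * z i) + npow b (s + 1 - 2 * z i)).
Proof.
move=> d2 bE s ds.
have d2' : 2 <= d%:R :> R by rewrite ler_nat.
have b0 : 0 < b by lra.
(* Normalizing by [a], the neighbours have squared norms [a (1 + y)] and [a (1 - y)] with
   [y = 2 z_i / a], and the centre has [s = a (1 - 1 / a)]. *)
set a := s + 1; have s40 : 40 <= s by nra.
have a0 : 0 < a by rewrite /a; lra.
have zs i : z i ^+ 2 <= s.
  rewrite /s (bigD1 i) //= lerDl sumr_ge0 // => j _; exact: sqr_ge0.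
have za i : `|2 * z i / a| < 1.
  rewrite normrM normfV (gtr0_norm a0) ltr_pdivrMr // mul1r.
  by have := zs i; rewrite ltr_norml /a; nra.
have -> : s = a * (1 - a^-1) by rewrite mulrBr divff ?gt_eqF // mulr1 /a; ring.
rewrite npowM // ?subr_gt0 ?invf_lt1 //; last by rewrite /a; lra.
apply: (@le_trans _ _ (\sum_(i < d) npow b a * (2 + (b + b ^+ 2) * (2 * z i / a) ^+ 2))).
  rewrite -mulr_sumr mulrCA ler_pM2l ?npow_gt0 // big_split /= sumr_const card_ord.
  rewrite -mulr_sumr.
  have -> : \sum_(i < d) (2 * z i / a) ^+ 2 = 4 * s / a ^+ 2.
    rewrite /s mulr_sumr mulr_suml; apply: eq_bigr => i _; field; by rewrite gt_eqF.
  have ba : 1 + b < a by rewrite /a; nra.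
  have := @npow_pred_le b a b0 ba; set n := npow _ _ => hn.
  apply: (@le_trans _ _ (2 * d%:R * (1 + b / (a - 1 - b)))).
    by rewrite ler_pM2l //; lra.
  have -> : a - 1 - b = s - b by rewrite /a; ring.
  have sb : 0 < s - b by rewrite /a in ba; lra.
  rewrite -[2 *+ d]mulr_natr [leLHS]mulrDr mulr1 lerD2l.
  have -> : (b + b ^+ 2) * (4 * s / a ^+ 2) = 2 * b * (2 * (1 + b) * s / a ^+ 2) by ring.
  rewrite (_ : 2 * d%:R * (b / (s - b)) = 2 * b * (d%:R / (s - b))); last by ring.
  rewrite ler_pM2l; last lra.
  rewrite ler_pdivrMr // mulrAC ler_pdivlMr ?exprn_gt0 // /a.
  rewrite bE; set D : R := d%:R in d2' ds *.
  (* As [2 (1 + b) = D + 1 / 2], the claim is [D (s + 1) ^ 2 <= (D + 1 / 2) s (s - b)]. The surplus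
     [s ^ 2 / 2] absorbs the lower-order terms because [s >= 10 D ^ 2]. *)
  have h1 : (2 * D + D + (D + 1 / 2) * (D / 2)) * s <= s ^+ 2 / 2.
    have : 2 * D + D + (D + 1 / 2) * (D / 2) <= 5 * D ^+ 2 by nra.
    have : 5 * D ^+ 2 <= s / 2 by lra.
    by nra.
  nra.
apply: ler_sum => i _; set y := 2 * z i / a in za *.
apply: (@le_trans _ _ (npow b a * (npow b (1 + y) + npow b (1 - y)))).
  by rewrite ler_pM2l ?npow_gt0 // npow_sym_ge // /y.
have /andP[y1 y2] : -1 < y < 1 by rewrite -ltr_norml /y.
rewrite mulrDr -!npowM //; [|lra|lra].
have yE : a * y = 2 * z i by rewrite /y; field; rewrite gt_eqF.
by rewrite mulrDr mulrBr mulr1 yE.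
Qed.

End power_function.

(** * Weights decaying with the graph distance *)

Section hitting_weight.
Context {R : realType} {V : choiceType}.
Implicit Types (c : {fset V * V}) (B : set V) (x y : V) (q : R).

(** Graphs are coded by finite sets of arcs: over countably many vertices these form a countable
    type, so a random domain becomes a discrete variable. *)
Definition arc c : rel V := fun x y => (x, y) \in c.

Definition nbr c x : {fset V} := [fset p.2 | p in c & p.1 == x]%fset.

Lemma in_nbr c x y : (y \in nbr c x) = arc c x y.
Proof.
apply/imfsetP/idP => [[p]|xy].
  by rewrite !inE /= => /andP[pc /eqP <-] ->; rewrite /arc -surjective_pairing.
by exists (x, y) => //; rewrite !inE /= eqxx andbT.
Qed.

Definition reach c B (n : nat) x : Prop :=
  exists p, [/\ path (arc c) x p, size p = n & B (last x p)].

Lemma reach0 c B x : B x -> reach c B 0 x.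
Proof. by move=> Bx; exists [::]. Qed.

Lemma reach_cons c B n x y : arc c x y -> reach c B n y -> reach c B n.+1 x.
Proof. by move=> xy [p [yp <- Bp]]; exists (y :: p); split => //=; rewrite xy. Qed.

Lemma reach_sub c c' B B' n x : (c `<=` c')%fset -> B `<=` B' ->
  reach c B n x -> reach c' B' n x.
Proof.
move=> cc BB [p [xp pn Bp]]; exists p; split => //; last exact: BB.
by apply: sub_path xp => u v; exact: (fsubsetP cc).
Qed.

Lemma reach_trans c B B' n m x : reach c B n x ->
  (forall y, B y -> exists2 k, (k <= m)%N & reach c B' k y) ->
  exists2 k, (k <= n + m)%N & reach c B' k x.
Proof.
move=> [p [xp <- Bp]] /(_ _ Bp)[k km [p' [pp' p'k B'p']]].
exists (size p + k)%N; first by rewrite leq_add2l.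
by exists (p ++ p'); rewrite cat_path size_cat last_cat xp p'k.
Qed.

(** Once loops are removed, the vertices after the first are distinct, and each is the head of an
    arc of [c]. *)
Lemma reach_short c B n x : reach c B n x ->
  exists2 k, (k <= #|` c|)%N & reach c B k x.
Proof.
move=> [p [+ _]]; case/shortenP => p' xp' /andP[_ up'] _ Bp'.
exists (size p'); last by exists p'.
have sub z s : path (arc c) z s -> {subset s <= [fset e.2 | e in c]%fset}.
  elim: s z => // u s IH z /= /andP[zu us] v; rewrite inE.
  case/predU1P => [->|]; last by apply: IH us v.
  by apply/imfsetP; exists (z, u).
move/(uniq_leq_size up')/leq_trans: (sub _ _ xp'); apply.
exact: leq_imfset_card.
Qed.

(* [q ^ (- n)], where [n] is the graph distance from [x] to [B], and [0] when
   [B] cannot be reached. *)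
Definition hitw q c B x : R :=
  if pselect (exists n, `[< reach c B n x >]) is left h then q^-1 ^+ ex_minn h
  else 0.

Lemma hitw_ge0 q c B x : 0 <= q -> 0 <= hitw q c B x.
Proof. by rewrite /hitw; case: pselect => // h q0; rewrite exprn_ge0 // invr_ge0. Qed.

Lemma hitw_le1 q c B x : 1 <= q -> hitw q c B x <= 1.
Proof.
move=> q1; rewrite /hitw; case: pselect => // h.
have q0 : 0 < q by exact: lt_le_trans q1.
by rewrite exprn_ile1 ?invr_ge0 ?invf_le1 // ltW.
Qed.

Lemma hitw_ge q c B n x : 1 <= q -> reach c B n x -> q^-1 ^+ n <= hitw q c B x.
Proof.
move=> q1 /asboolP xn; have q0 : 0 < q by exact: lt_le_trans q1.
rewrite /hitw; case: pselect => [h|[]]; last by exists n.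
case: ex_minnP => m _ /(_ _ xn) mn.
by rewrite ler_wiXn2l ?invr_ge0 ?invf_le1 // ltW.
Qed.

Lemma hitw_reach q c B x : 0 <= q ->
  hitw q c B x = 0 \/ exists2 n, reach c B n x & hitw q c B x = q^-1 ^+ n.
Proof.
rewrite /hitw; case: pselect => [h|]; [right|by left].
by case: ex_minnP => m /asboolP xm _; exists m.
Qed.

Lemma hitw_in q c B x : 1 <= q -> B x -> hitw q c B x = 1.
Proof.
move=> q1 Bx; apply/eqP; rewrite eq_le hitw_le1 //=.
by have := hitw_ge q1 (reach0 c Bx).
Qed.

Lemma hitw_sub q c c' B B' x : 1 <= q -> (c `<=` c')%fset -> B `<=` B' ->
  hitw q c B x <= hitw q c' B' x.
Proof.
move=> q1 cc BB; have q0 : 0 <= q by exact: le_trans q1.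
have [->|[n xn ->]] := hitw_reach c B x q0; first exact: hitw_ge0.
by apply: hitw_ge => //; exact: reach_sub xn.
Qed.

(** The first vertex [y] of a shortest path to [B] has at least [2 K] times the weight of [x], which
    alone pays for the left-hand side. If [B] is out of reach, that side is [0]. *)
Lemma hitw_superharmonic (K : nat) c B x : (0 < K)%N -> (#|` nbr c x| <= K)%N ->
  ~ B x ->
  2 * hitw (2 * K%:R) c B x * #|` nbr c x|%:R <=
    \sum_(y <- nbr c x) hitw (2 * K%:R) c B y.
Proof.
move=> K0 cK nBx; set q := 2 * K%:R.
have q1 : 1 <= q by rewrite /q -natrM ler1n muln_gt0.
have q0 : 0 < q by exact: lt_le_trans q1.
have [->|[n [p [+ + Bp]] ->]] := hitw_reach c B x (ltW q0).
  by rewrite mulr0 mul0r sumr_ge0 // => y _; rewrite hitw_ge0 // ltW.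
case: n p Bp => [|n] [|y p]//= Bp /andP[xy yp] [pn].
rewrite (big_fsetD1 y) ?in_nbr //=; apply: (@le_trans _ _ (hitw q c B y)).
  apply: (@le_trans _ _ (q^-1 ^+ n)); last by apply: hitw_ge => //; exists p.
  apply: (@le_trans _ _ (2 * q^-1 ^+ n.+1 * K%:R)).
    by rewrite ler_wpM2l ?ler_nat // mulr_ge0 // exprn_ge0 // invr_ge0 ltW.
  by rewrite exprS mulrAC mulrA divff ?mul1r // gt_eqF.
by rewrite lerDl sumr_ge0 // => z _; rewrite hitw_ge0 // ltW.
Qed.

End hitting_weight.

(** * Lattice geometry *)

Section lattice.
Variable d : nat.
Implicit Types (x y z : site d) (c : {fset site d * site d}) (i : 'I_d).

Definition nsq x : nat := (\sum_(i < d) absz (x 0%R i) ^ 2)%N.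

Lemma nsqE (R : realType) x : (nsq x)%:R = \sum_(i < d) ((x 0 i)%:~R : R) ^+ 2.
Proof.
rewrite /nsq natr_sum; apply: eq_bigr => i _.
by rewrite natrX natr_absz intr_norm real_normK ?num_real.
Qed.

Lemma nsq_eq0 x : nsq x = 0%N -> x = 0.
Proof.
move/eqP; rewrite /nsq sum_nat_eq0 => /forallP x0; apply/rowP => i.
by have := x0 i; rewrite /= expn_eq0 absz_eq0 andbT mxE => /eqP.
Qed.

Lemma nsq0 : nsq 0 = 0%N.
Proof. by rewrite /nsq big1 // => i _; rewrite mxE. Qed.

Lemma absz_sqr_le_nsq x i : (absz (x 0%R i) ^ 2 <= nsq x)%N.
Proof. by rewrite /nsq (bigD1 i) //= leq_addr. Qed.

Definition ustep i (b : bool) : site d := (if b then 1 else -1) *: delta_mx 0 i.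

Lemma ustepE i b j : ustep i b 0 j = if i == j then (if b then 1 else -1) else 0.
Proof. by rewrite !mxE eqxx /= eq_sym; case: eqVneq; rewrite ?mulr1 ?mulr0. Qed.

Lemma ustep_inj : injective (fun p : 'I_d * bool => ustep p.1 p.2).
Proof.
move=> [i b] [j b'] /= /rowP e; have := e j; have := e i.
by rewrite !ustepE !eqxx (eq_sym j); case: eqVneq => [->|_]; case: b {e}; case: b'.
Qed.

Lemma nsq_move x y i : (forall j, j != i -> y 0 j = x 0 j) ->
  (nsq y + absz (x 0%R i) ^ 2 = nsq x + absz (y 0%R i) ^ 2)%N.
Proof.
move=> xy; rewrite /nsq (bigD1 i) //= [X in (_ = X + _)%N](bigD1 i) //=.
by rewrite (eq_bigr (fun j => absz (x 0%R j) ^ 2)%N) => [|j /xy ->//]; lia.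
Qed.

Lemma ustep_neq x i b j : j != i -> (x + ustep i b) 0 j = x 0 j.
Proof. by move=> ji; rewrite mxE ustepE eq_sym (negPf ji) addr0. Qed.

Lemma ustep_eq x i b : (x + ustep i b) 0 i = x 0 i + (if b then 1 else -1).
Proof. by rewrite mxE ustepE eqxx. Qed.

Lemma zd_adjE x y : zd_adj x y = (\sum_(i < d) absz (x 0 i - y 0 i)%R == 1)%N.
Proof.
rewrite /zd_adj -(eqr_nat int) natr_sum; congr (_ == _).
by apply: eq_bigr => i _; rewrite -abszE natz.
Qed.

Lemma zd_adjP x y : reflect (exists i b, y = x + ustep i b) (zd_adj x y).
Proof.
rewrite zd_adjE; apply: (iffP idP) => [/sum_nat_eq1 [i [_ xyi xy0]]|[i [b ->]]].
  exists i, (x 0 i <= y 0 i); apply/rowP => j.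
  have [->|ji] := eqVneq j i; last by rewrite ustep_neq //; have := xy0 j ji isT; lia.
  by rewrite ustep_eq; move: xyi; case: ifP; lia.
rewrite (bigD1 i) //= big1 => [|j ji]; first by rewrite ustep_eq; case: b; lia.
by rewrite ustep_neq // subrr.
Qed.

Lemma nsq_ustep (R : realType) x i b :
  (nsq (x + ustep i b))%:R =
    (nsq x)%:R + 1 + (if b then 1 else -1) * 2 * (x 0 i)%:~R :> R.
Proof.
rewrite !nsqE (bigD1 i) //= [X in _ = X + _ + _](bigD1 i) //=.
rewrite ustep_eq (eq_bigr (fun j => (x 0 j)%:~R ^+ 2)) => [|j ji]; last by rewrite ustep_neq.
by rewrite intrD; case: b; rewrite /= ?intrN; ring.
Qed.

Lemma nsq_adj_lt x y k : zd_adj x y -> (nsq x < k ^ 2)%N ->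
  (nsq y <= (k.+1) ^ 2)%N.
Proof.
case/zd_adjP => i [b ->] xk; have := absz_sqr_le_nsq x i.
have := nsq_move (fun j => @ustep_neq x i b j); rewrite ustep_eq.
by case: b; nia.
Qed.

(** Some coordinate has [d |x_i| > k], as otherwise [nsq x <= k ^ 2]. Moving it towards [0] lowers
    [nsq] by [2 |x_i| - 1 >= |x_i|]. *)
Lemma inward_step x k : (0 < d)%N -> (k ^ 2 < nsq x)%N ->
  exists y, [/\ zd_adj x y, (nsq y < nsq x)%N &
    (d * nsq y + k < d * nsq x)%N].
Proof.
move=> d0 xk.
have [i ik] : exists i, (k < d * absz (x 0%R i))%N.
  apply/existsP; apply: contraLR xk => /existsPn xk.
  rewrite -leqNgt -(@leq_pmul2l (d * d)) ?muln_gt0 ?d0 //.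
  rewrite /nsq big_distrr /= (@leq_trans (\sum_(i < d) k ^ 2)%N) //.
    by apply: leq_sum => i _; have := xk i; nia.
  by rewrite sum_nat_const card_ord leq_mul // leq_pmulr.
set b := x 0 i <= 0.
have := nsq_move (fun j => @ustep_neq x i b j); rewrite ustep_eq => e.
have xi : (absz (x 0%R i) = absz (x 0%R i + (if b then 1 else -1))%R + 1)%N.
  by move: ik; rewrite /b; case: ifP; nia.
exists (x + ustep i b); split; first by apply/zd_adjP; exists i, b.
- by move: e; rewrite xi; nia.
- by move: e ik; rewrite xi; nia.
Qed.

Definition zd_graph c : Prop :=
  (forall x y, arc c x y -> zd_adj x y) /\ (forall x y, arc c x y -> arc c y x).

Definition star_seq x : seq (site d) :=
  [seq x + ustep p.1 p.2 | p <- enum [the finType of ('I_d * bool)%type]].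

Lemma star_uniq x : uniq (star_seq x).
Proof. by rewrite map_inj_uniq ?enum_uniq // => p q /addrI/ustep_inj. Qed.

Lemma mem_star x y : (y \in star_seq x) = zd_adj x y.
Proof.
apply/mapP/zd_adjP => [[[i b] _ ->]|[i [b ->]]]; first by exists i, b.
by exists (i, b) => //; rewrite mem_enum.
Qed.

Lemma size_star x : size (star_seq x) = (2 * d)%N.
Proof. by rewrite size_map -cardE card_prod card_ord card_bool mulnC. Qed.

Lemma card_nbr_le c x : zd_graph c -> (#|` nbr c x| <= 2 * d)%N.
Proof.
move=> [cz _]; rewrite -(size_star x); apply: uniq_leq_size => // y.
by rewrite in_nbr mem_star => /cz.
Qed.

Lemma perm_nbr_star c x : zd_graph c ->
  (forall y, zd_adj x y -> arc c x y) -> perm_eq (nbr c x) (star_seq x).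
Proof.
move=> [cz _] xc; apply: uniq_perm; rewrite ?star_uniq // => y.
by rewrite in_nbr mem_star; apply/idP/idP; [exact: cz|exact: xc].
Qed.

(** The argument is a squared radius, so that balls of non-integer radius are covered too. *)
Definition ball_in c (n : nat) : Prop := forall x y,
  (nsq x <= n)%N -> (nsq y <= n)%N -> zd_adj x y -> arc c x y.

Lemma ball_in0 c : ball_in c 0.
Proof.
move=> x y; rewrite !leqn0 => /eqP/nsq_eq0 -> /eqP/nsq_eq0 ->.
by rewrite zd_adjE big1 // => i _; rewrite mxE subrr.
Qed.

(** While [nsq x > (r - 2) ^ 2], an inward step lowers [d * nsq x] by more than [r - 2], hence
    [3 * d * nsq x] by at least [r + 1]; the excess to remove is at most [18 * d * (r + 1)]. With
    truncated subtraction this also holds for [r < 2]. *)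
Lemma reach_ball c n x r : (0 < d)%N -> ball_in c n -> (nsq x <= n)%N ->
  (n <= r.+1 ^ 2)%N ->
  exists2 k, (k <= 18 * d)%N & reach c [set y | nsq y <= (r - 2) ^ 2]%N k x.
Proof.
move=> d0 cn xn nr.
have : (3 * d * nsq x <= 3 * d * (r - 2) ^ 2 + (18 * d) * r.+1)%N.
  apply: (@leq_trans (3 * d * r.+1 ^ 2)); first by rewrite leq_mul // (leq_trans xn).
  have : (r.+1 ^ 2 <= (r - 2) ^ 2 + 6 * r.+1)%N by nia.
  by nia.
elim: (18 * d)%N x xn => [|m IH] x xn h;
    have [xr|xr] := leqP (nsq x) ((r - 2) ^ 2).
- by exists 0%N => //; exact: reach0.
- by exfalso; move: h; rewrite mul0n addn0 leq_pmul2l ?muln_gt0 // leqNgt xr.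
- by exists 0%N => //; exact: reach0.
have [y [xy yx yd]] := inward_step d0 xr.
have yn : (nsq y <= n)%N by rewrite (leq_trans (ltnW yx)).
have [|k km yk] := IH y yn.
  move: h yd; set N := nsq x; set N' := nsq y; set M := ((r - 2) ^ 2)%N.
    have : (r.+1 <= 3 * (r - 2).+1)%N by lia.
    rewrite -!mulnA mulSn; set e := (m * r.+1)%N.
    set a := (d * N)%N; set a' := (d * N')%N; set q := (d * M)%N; lia.
by exists k.+1; [|apply: (@reach_cons _ _ _ _ x y) => //; exact: cn].
Qed.

Lemma reach_origin c n x : (0 < d)%N -> ball_in c n -> (nsq x <= n)%N ->
  exists2 k, (k <= nsq x)%N & reach c [set 0] k x.
Proof.
move=> d0 cn; have [m] := ubnP (nsq x); elim: m x => // m IH x xm xn.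
have [x0|x0] := posnP (nsq x).
  by exists 0%N => //; apply: reach0; exact: nsq_eq0.
have [//|y [xy yx _]] := @inward_step x 0 d0.
have [|//|k ky yk] := IH y; [exact: leq_trans yx _|exact: leq_trans (ltnW yx) _|].
exists k.+1; first exact: leq_ltn_trans yx.
by apply: reach_cons yk; apply: cn => //; exact: leq_trans (ltnW yx) _.
Qed.

(** The cube of points with coordinates in [0 .. r %/ d] lies in the ball, and each of its points is
    the tail of an arc: an inward step, or any unit step from the origin, which stays in the ball as
    [0 < r]. *)
Lemma ball_in_card c r : (0 < d)%N -> (0 < r)%N -> ball_in c (r ^ 2) ->
  ((r %/ d).+1 ^ d <= #|` c|)%N.
Proof.
move=> d0 r0 cr; set m := (r %/ d)%N.
pose g (f : {ffun 'I_d -> 'I_m.+1}) : site d := \row_i (f i : nat)%:Z.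
have g_inj : injective g.
  move=> f f' /rowP e; apply/ffunP => i; apply/val_inj.
  by have := e i; rewrite !mxE => -[].
have gc f : g f \in [fset e.1 | e in c]%fset.
  have gr : (nsq (g f) <= r ^ 2)%N.
    rewrite /nsq (@leq_trans (\sum_(i < d) m ^ 2)%N) //.
      by apply: leq_sum => i _; rewrite mxE /= leq_sqr -ltnS.
    rewrite sum_nat_const card_ord.
    have : (m * d <= r)%N by exact: leq_trunc_div.
    by nia.
  suff [y yr gy] : exists2 y, (nsq y <= r ^ 2)%N & zd_adj (g f) y.
    by apply/imfsetP; exists (g f, y) => //=; exact: cr.
  have [g0|g0] := posnP (nsq (g f)); last first.
    have [//|y [gy yg _]] := @inward_step (g f) 0 d0.
    by exists y => //; exact: leq_trans (ltnW yg) _.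
  have gy : zd_adj (g f) (g f + ustep (Ordinal d0) true).
    by apply/zd_adjP; exists (Ordinal d0), true.
  exists (g f + ustep (Ordinal d0) true) => //.
  have := nsq_move (fun j => @ustep_neq (g f) (Ordinal d0) true j).
  by rewrite ustep_eq (nsq_eq0 g0) nsq0 !mxE; nia.
have <- : #|{ffun 'I_d -> 'I_m.+1}| = (m.+1 ^ d)%N.
  by rewrite card_ffun !card_ord.
rewrite cardE -(size_map g); apply: leq_trans (leq_imfset_card imfset_key fst (mem c)).
apply: uniq_leq_size; first by rewrite map_inj_uniq ?enum_uniq.
by move=> _ /mapP[f _ ->]; exact: gc.
Qed.

Definition rad c : nat := \max_(r < (d * #|` c|).+1 | `[< ball_in c (r ^ 2) >]) r.

Lemma rad_ball c : ball_in c (rad c ^ 2).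
Proof.
have b0 : ball_in c (0 ^ 2) by rewrite exp0n //; exact: (@ball_in0 c).
set A := [pred r : 'I_(d * #|` c|).+1 | `[< ball_in c (r ^ 2) >]].
have A0 : (0 < #|A|)%N.
  by apply/card_gt0P; exists ord0; rewrite inE; exact: b0.
have [r] := eq_bigmax_cond (fun r : 'I__ => val r) A0.
by rewrite inE /= => cr e; rewrite /rad e.
Qed.

Lemma le_rad c r : (0 < d)%N -> ball_in c (r ^ 2) -> (r <= rad c)%N.
Proof.
move=> d0 cr; have [->//|r0] := posnP r.
have rc : (r < (d * #|` c|).+1)%N.
  have := ball_in_card d0 r0 cr; have : (r < (r %/ d).+1 * d)%N by exact: ltn_ceil.
  have : ((r %/ d).+1 <= (r %/ d).+1 ^ d)%N by rewrite -[leqLHS]expn1 leq_pexp2l.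
  by nia.
by apply: (@leq_bigmax_cond _ _ val (Ordinal rc)); exact/asboolP.
Qed.

Lemma rad_sub c c' : (0 < d)%N -> (c `<=` c')%fset -> (rad c <= rad c')%N.
Proof.
move=> d0 cc; apply: le_rad => // x y xr yr xy.
by apply: (fsubsetP cc); exact: rad_ball xy.
Qed.

End lattice.

(** * The potential *)

Section potential.
Context {R : realType} {d : nat}.
Hypothesis d2 : (2 <= d)%N.
Implicit Types (x y : site d) (c : {fset site d * site d}) (r : nat).

Let d0 : (0 < d)%N. Proof. exact: ltn_trans d2. Qed.

(* [|x| ^ (- 2 dexp)] is subharmonic as [2 dexp > d - 2], and its gradient at
   distance [r], of order [r ^ (- 2 dexp - 1)], is much larger than
   [r ^ (- d)]. *)
Definition dexp : R := d%:R / 2 - 3 / 4.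
Definition wbase : R := 2 * (2 * d)%:R.
(* Within squared radius [nearsq] of the origin the power need not be
   subharmonic; there it is dominated by [orgscale * org]. *)
Definition nearsq : nat := 10 * d ^ 2.
Definition orgscale : R := wbase ^+ nearsq.

(** The absolute slope of [s ^ (- 2 dexp)] at [s = r - 1], so that convexity puts [bulk] above it
    one unit further inside ([bulk_core]). *)
Definition layscale r : R := 2 * dexp * npow (2 * dexp + 1) r.-1%:R.
Definition bulk r x : R := npow dexp (nsq x)%:R - npow dexp (r.-1 ^ 2)%:R.
Definition core r : set (site d) := [set y | nsq y <= (r - 2) ^ 2]%N.

Definition lay c x : R := layscale (rad c) * hitw wbase c (core (rad c)) x.
Definition org c x : R := hitw wbase c [set 0] x.
Definition pot c x : R :=
  Num.max (bulk (rad c) x) (Num.max (orgscale * org c x) (lay c x)).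

(** A supermartingale for the walk away from the origin. The constant keeps it nonnegative,
    [layscale (rad c)] makes it nonincreasing in [c], and subtracting [org] produces the term [org]
    of [gain]. *)
Definition energy c x : R :=
  2 + orgscale + layscale (rad c) - pot c x - org c x.

Definition gain c x : R :=
  org c x + (if (#|` nbr c x| < 2 * d)%N then lay c x else 0).

Lemma dexp_gt0 : 0 < dexp.
Proof. by have : 2 <= d%:R :> R by [rewrite ler_nat]; rewrite /dexp; lra. Qed.

Lemma wbase_ge1 : 1 <= wbase.
Proof. by rewrite /wbase -natrM ler1n !muln_gt0. Qed.

Lemma wbase_gt0 : 0 < wbase. Proof. exact: lt_le_trans wbase_ge1. Qed.

Lemma orgscale_ge1 : 1 <= orgscale.
Proof. by rewrite exprn_ege1 // wbase_ge1. Qed.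

Lemma layscale_gt0 r : 0 < layscale r.
Proof. by rewrite mulr_gt0 ?npow_gt0 // mulr_gt0 ?dexp_gt0. Qed.

Lemma layscale_nincr r r' : (r <= r')%N -> layscale r' <= layscale r.
Proof.
move=> rr; have b0 := dexp_gt0; rewrite ler_pM2l ?mulr_gt0 // npow_nincr //; first lra.
by rewrite -!subn1 leq_sub2r.
Qed.

Lemma org_ge0 c x : 0 <= org c x.
Proof. by rewrite hitw_ge0 // ltW ?wbase_gt0. Qed.

Lemma org_le1 c x : org c x <= 1. Proof. by rewrite hitw_le1 // wbase_ge1. Qed.

Lemma lay_ge0 c x : 0 <= lay c x.
Proof. by rewrite mulr_ge0 ?hitw_ge0 // ltW ?layscale_gt0 ?wbase_gt0. Qed.

Lemma bulk_le1 r x : bulk r x <= 1.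
Proof.
rewrite /bulk; have := npow_gt0 dexp (r.-1 ^ 2)%:R.
by have := npow_le1 (nsq x) (ltW dexp_gt0); lra.
Qed.

Lemma bulk_sub r r' x : (r <= r')%N -> bulk r x <= bulk r' x.
Proof.
move=> rr; rewrite lerD2l lerN2 npow_nincr ?(ltW dexp_gt0) //.
by rewrite leq_sqr -!subn1 leq_sub2r.
Qed.

Lemma bulk_gt0 r x : 0 < bulk r x -> (nsq x < r.-1 ^ 2)%N.
Proof.
rewrite subr_gt0 => h; rewrite ltnNge; apply/negP => /(npow_nincr (ltW dexp_gt0)).
by rewrite leNgt h.
Qed.

(** With [m = r - 1], this is the convexity bound [(m - 1) ^ (- 2 b) - m ^ (- 2 b) >= 2 b m ^ (- 2 b
    - 1)] for [b = dexp]. *)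
Lemma bulk_core r x : x != 0 -> core r x -> layscale r <= bulk r x.
Proof.
move=> x0 xr; have x1 : (0 < nsq x)%N.
  by rewrite lt0n; apply: contra x0 => /eqP/nsq_eq0 ->.
(* A nonzero point of the core forces [r - 2 >= 1], so none of the subtractions below is
   truncated. *)
have r3 : (3 <= r)%N by move: xr x1; rewrite /core /=; nia.
set m := r.-1; have m2 : 2 <= m%:R :> R by rewrite ler_nat /m; lia.
have b0 := dexp_gt0.
have h : npow dexp ((r - 2) ^ 2)%:R <= npow dexp (nsq x)%:R.
  exact: npow_nincr (ltW b0) xr.
rewrite /bulk /layscale -/m.
apply: (@le_trans _ _ (npow dexp ((r - 2) ^ 2)%:R -
    npow dexp (m ^ 2)%:R)); last by rewrite lerD2r.
rewrite !natrX !npow_sqr ?ltr0n; [|by rewrite /m; lia|by lia].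
have -> : (r - 2)%:R = m%:R * (1 - m%:R^-1) :> R.
  rewrite mulrBr divff ?mulr1; last by rewrite gt_eqF //; lra.
  by rewrite (_ : (r - 2 = m - 1)%N) ?natrB // /m; lia.
have mi : m%:R^-1 < 1 :> R by rewrite invf_lt1; lra.
rewrite npowM; [|lra|by rewrite subr_gt0].
have := @npow_pred_ge R (2 * dexp) m%:R; move=> /(_ ltac:(lra) ltac:(lra)).
rewrite npowD (@npow_nat R 1); last lra.
rewrite expr1; have := npow_gt0 (2 * dexp) m%:R.
set p := npow (2 * dexp) _; set p' := npow _ (1 - _) => p0 hp.
have -> : 2 * dexp * (p * m%:R^-1) = p * (2 * dexp / m%:R) by ring.
rewrite -[X in _ <= _ - X]mulr1 -mulrBr ler_pM2l //; lra.
Qed.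

(* Up to the normalization [layscale], which telescopes along a growing
   sequence of domains, the potential increases with the domain. *)
Lemma pot_sub c c' x : (c `<=` c')%fset ->
  pot c x - layscale (rad c) <= pot c' x - layscale (rad c').
Proof.
move=> cc; have rr := rad_sub d0 cc.
have AA := layscale_nincr rr.
rewrite lerBlDr; rewrite {1}/pot !ge_max; apply/and3P; split.
- apply: (@le_trans _ _ (pot c' x)); last lra.
  by rewrite /pot le_max bulk_sub.
- apply: (@le_trans _ _ (pot c' x)); last lra.
  rewrite /pot !le_max; apply/or3P/Or32.
  by rewrite ler_pM2l ?(lt_le_trans _ orgscale_ge1) // hitw_sub ?wbase_ge1.
- apply: (@le_trans _ _ (lay c' x - layscale (rad c') + layscale (rad c))).
    have h : hitw wbase c (core (rad c)) x <= hitw wbase c' (core (rad c')) x.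
      apply: hitw_sub => //; first exact: wbase_ge1.
      by move=> y /= /leq_trans; apply; rewrite leq_sqr leq_sub2r.
    have := hitw_le1 c' (core (rad c')) x wbase_ge1.
    have := hitw_ge0 c (core (rad c)) x (ltW wbase_gt0).
    have := layscale_gt0 (rad c'); rewrite /lay; nra.
  by rewrite !lerD2r /pot !le_max lexx !orbT.
Qed.

Lemma pot_ge0 c x : 0 <= pot c x.
Proof. by rewrite /pot !le_max lay_ge0 !orbT. Qed.

(** Positivity of [bulk] puts [x] strictly inside radius [rad c - 1]. All its lattice neighbours
    then lie in the ball of radius [rad c], so the averaging is that of the full lattice. *)
Lemma bulk_subharmonic c x : zd_graph c -> 0 < bulk (rad c) x ->
  (nearsq <= nsq x)%N ->
  #|` nbr c x| = (2 * d)%N /\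
  bulk (rad c) x * (2 * d)%:R <= \sum_(y <- nbr c x) bulk (rad c) y.
Proof.
move=> cz /bulk_gt0; set r := rad c => xr xn.
have r2 : (r.-1.+1 <= r)%N by move: xr; case: r.
have nx : forall y, zd_adj x y -> arc c x y.
  move=> y xy; apply: (@rad_ball d c) => //.
    by rewrite (leq_trans (ltnW xr)) // leq_sqr leq_pred.
  by rewrite (leq_trans (nsq_adj_lt xy xr)) // leq_sqr.
have pe := perm_nbr_star cz nx; split; first by rewrite (perm_size pe) size_star.
rewrite (perm_big _ pe) /= /star_seq big_map /= big_enum /=.
rewrite -(pair_bigA _ (fun i b => bulk r (x + ustep i b))) /=.
rewrite (eq_bigr (fun i => (npow dexp ((nsq x)%:R + 1 + 2 * (x 0 i)%:~R)
   + npow dexp ((nsq x)%:R + 1 - 2 * (x 0 i)%:~R)) - 2 * npow dexp (r.-1 ^ 2)%:R)); last first.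
  move=> i _; rewrite big_bool /= /bulk !nsq_ustep /= !mul1r !mulN1r !mulNr; ring.
rewrite sumrB sumr_const card_ord /bulk mulrBl.
have := @npow_subharmonic R d dexp (fun i => (x 0 i)%:~R) d2 erefl.
rewrite /= -nsqE -natrX -natrM ler_nat => /(_ xn).
rewrite -[_ *+ d]mulr_natr natrM; lra.
Qed.

(** The proof follows which of the three functions attains the maximum at [x]; at the neighbours
    [pot] dominates that same function. *)
Lemma pot_subharmonic c x : zd_graph c -> x != 0 ->
  (pot c x + if (#|` nbr c x| < 2 * d)%N then lay c x else 0) * #|` nbr c x|%:R
    <= \sum_(y <- nbr c x) pot c y.
Proof.
move=> cz x0; set n := #|` nbr c x|.
have nd : (n <= 2 * d)%N by exact: card_nbr_le.
(* The origin weight doubles, so its surplus [orgscale * org c x] covers [lay c x]. *)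
have orgP : lay c x <= orgscale * org c x -> bulk (rad c) x <= orgscale * org c x ->
    (pot c x + if (n < 2 * d)%N then lay c x else 0) * n%:R <= \sum_(y <- nbr c x) pot c y.
  move=> h1 h2; have -> : pot c x = orgscale * org c x by rewrite /pot (max_l h1) max_r.
  have x0' : ~ [set 0] x by move=> /= xE; rewrite xE eqxx in x0.
  apply: (@le_trans _ _ (\sum_(y <- nbr c x) orgscale * org c y)); last first.
    by apply: ler_sum => y _; rewrite /pot !le_max lexx !orbT.
  rewrite -mulr_sumr; have := @hitw_superharmonic R _ (2 * d) c [set 0] x _ nd x0'.
  rewrite muln_gt0 d0 -/wbase => /(_ isT) /(ler_wpM2l (le_trans ler01 orgscale_ge1)).
  apply: le_trans; rewrite -/(org c x) -/n.
  rewrite mulrA (_ : orgscale * (2 * org c x) = 2 * (orgscale * org c x)); last by ring.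
  rewrite ler_wpM2r //; case: ifP => _; last have := lay_ge0 c x; lra.
(* Off the core the layer doubles, and its surplus is exactly [lay c x]. *)
have layP : ~ core (rad c) x -> pot c x = lay c x ->
    (pot c x + if (n < 2 * d)%N then lay c x else 0) * n%:R <= \sum_(y <- nbr c x) pot c y.
  move=> xB ->.
  apply: (@le_trans _ _ (\sum_(y <- nbr c x) lay c y)); last first.
    by apply: ler_sum => y _; rewrite /pot !le_max lexx !orbT.
  rewrite -mulr_sumr; have := @hitw_superharmonic R _ (2 * d) c _ x _ nd xB.
  rewrite muln_gt0 d0 -/wbase => /(_ isT) /(ler_wpM2l (ltW (layscale_gt0 (rad c)))).
  apply: le_trans; rewrite -/n mulrA mulrCA -/(lay c x).
  rewrite ler_wpM2r //; case: ifP => _; last have := lay_ge0 c x; lra.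
(* Here [x] has full degree, so no boundary term is to be paid for. *)
have bulkP : lay c x <= bulk (rad c) x -> orgscale * org c x < bulk (rad c) x ->
    (pot c x + if (n < 2 * d)%N then lay c x else 0) * n%:R <= \sum_(y <- nbr c x) pot c y.
  move=> h1 h2; have -> : pot c x = bulk (rad c) x.
    by rewrite /pot max_l // ge_max h1 ltW.
  have b0 : 0 < bulk (rad c) x.
    by apply: le_lt_trans h2; rewrite mulr_ge0 ?org_ge0 // (le_trans ler01) // orgscale_ge1.
  (* Closer to the origin, at most [nearsq] steps lead to [0], so [orgscale * org c x >= 1 >= bulk],
     against the assumption. *)
  have xn : (nearsq <= nsq x)%N.
    rewrite leqNgt; apply/negP => xn.
    have [|k kx xk] := @reach_origin d c (rad c ^ 2) x d0 (@rad_ball d c).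
      by rewrite (leq_trans (ltnW (bulk_gt0 b0))) // leq_sqr leq_pred.
    move: h2; apply/negP; rewrite -leNgt; apply: le_trans (bulk_le1 _ _) _.
    rewrite -(@ler_pM2l _ orgscale^-1) ?invr_gt0 ?(lt_le_trans _ orgscale_ge1) //.
    rewrite mulr1 mulKf; last by rewrite gt_eqF // (lt_le_trans _ orgscale_ge1).
    apply: le_trans (hitw_ge wbase_ge1 xk).
    rewrite /orgscale -exprVn ler_wiXn2l ?invr_ge0 ?invf_le1 ?wbase_ge1
      ?(ltW wbase_gt0) ?wbase_gt0 //.
    exact: leq_trans kx (ltnW xn).
  have [nE h] := bulk_subharmonic cz b0 xn.
  rewrite /n nE ltnn addr0; apply: le_trans h _; apply: ler_sum => y _.
  by rewrite /pot le_max lexx.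
(* On the core the layer equals [layscale (rad c)] and so does not exceed [bulk]: the layer case is
   needed only off the core. *)
have [xB|xB] := pselect (core (rad c) x).
  have h1 : lay c x <= bulk (rad c) x.
    by rewrite /lay hitw_in ?mulr1 ?wbase_ge1 // bulk_core.
  have [h2|h2] := leP (bulk (rad c) x) (orgscale * org c x); last exact: bulkP.
  by apply: orgP => //; exact: le_trans h2.
have [h1|h1] := leP (bulk (rad c) x) (orgscale * org c x).
  have [h2|h2] := leP (lay c x) (orgscale * org c x); first exact: orgP.
  by apply: layP => //; rewrite /pot (max_r (ltW h2)) max_r // (le_trans h1) // ltW.
have [h2|h2] := leP (lay c x) (bulk (rad c) x); first exact: bulkP.
apply: layP => //; have h3 := lt_trans h1 h2.
by rewrite /pot (max_r (ltW h3)) max_r // ltW.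
Qed.

Lemma energy_ge0 c x : 0 <= energy c x.
Proof.
have h1 := bulk_le1 (rad c) x; have h2 := org_le1 c x; have h3 := org_ge0 c x.
have A0 := layscale_gt0 (rad c); have H1 := orgscale_ge1.
have h4 : lay c x <= layscale (rad c).
  by rewrite /lay ler_piMr ?hitw_le1 ?wbase_ge1 // ltW.
have : pot c x <= 1 + orgscale + layscale (rad c).
  rewrite /pot !ge_max; apply/and3P; split; [lra|nra|lra].
by rewrite /energy; lra.
Qed.

Lemma energy_le c x : energy c x <= 2 + orgscale + layscale 0.
Proof.
have := pot_ge0 c x; have := org_ge0 c x; have := layscale_nincr (leq0n (rad c)).
by rewrite /energy; lra.
Qed.

Lemma gain_ge0 c x : 0 <= gain c x.
Proof. by rewrite addr_ge0 ?org_ge0 //; case: ifP => // _; exact: lay_ge0. Qed.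

Lemma energy_step c c' x : (c `<=` c')%fset -> zd_graph c -> x != 0 ->
  \sum_(y <- nbr c x) energy c' y + gain c x * #|` nbr c x|%:R
    <= energy c x * #|` nbr c x|%:R.
Proof.
move=> cc cz x0; have h1 := pot_subharmonic cz x0.
have x0' : ~ [set 0] x by move=> /= xE; rewrite xE eqxx in x0.
have := @hitw_superharmonic R _ (2 * d) c [set 0] x _ (card_nbr_le x cz) x0'.
rewrite muln_gt0 d0 -/wbase => /(_ isT); rewrite -/(org c x) => h2.
(* By [pot_sub] and the monotonicity of [org], replacing [c'] by [c] can only raise the energy. *)
have h3 : \sum_(y <- nbr c x) energy c' y <=
    \sum_(y <- nbr c x) (2 + orgscale + layscale (rad c) - pot c y - org c y).
  apply: ler_sum => y _; have := pot_sub y cc.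
  have : org c y <= org c' y by exact: hitw_sub wbase_ge1 cc _.
  by rewrite /energy; lra.
apply: le_trans (lerD h3 (lexx _)) _; rewrite !sumrB big_const_seq.
rewrite count_predT iter_addr_0 -[_ *+ size _]mulr_natr.
move: h1 h2; rewrite /gain /energy; set n := #|` _|%:R; set g := if _ then _ else _.
set s1 := \sum_(y <- _) pot _ _; set s2 := \sum_(y <- _) _; nra.
Qed.

End potential.

(** * Divergence of the gain *)

Section boundary_gain.
Context {R : realType} {d : nat}.
Hypothesis d2 : (2 <= d)%N.
Implicit Types (x y : site d) (c : {fset site d * site d}).

Let d0 : (0 < d)%N. Proof. exact: ltn_trans d2. Qed.

Local Notation w := (@wbase R d).
Local Notation b := (@dexp R d).

Lemma ln_wbase_gt0 : 0 < ln w.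
Proof. by rewrite ln_gt0 // /wbase -natrM ltr1n; lia. Qed.

(** Chosen so that [shape_const * ln f] steps cost a factor [w ^ (- shape_const * ln f) = f ^ (- 1 /
    2)]. *)
Definition shape_const : R := (2 * ln w)^-1.

(** The factor [w ^ (18 d + 1)] pays for the [18 d] steps of [reach_ball] and one spare step;
    [d ^ d] comes from comparing [(r + 1) ^ d] with the number of arcs. *)
Definition laybound : R := d%:R ^+ d * w ^+ (18 * d).+1 / (2 * b).

Lemma laybound_gt0 : 0 < laybound.
Proof.
by rewrite divr_gt0 ?mulr_gt0 ?exprn_gt0 ?wbase_gt0 ?ltr0n ?dexp_gt0.
Qed.

(** After [k] steps to the ball, [18 d] more reach the core, so the weight is at least of order
    [(r + 1) ^ (- 1 / 2)]. With [layscale], of order [r ^ (- (2 b + 1))], the exponents add up to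
    exactly [d], and [(r + 1) ^ d] is at most [d ^ d] times the number of arcs. *)
Lemma lay_ge c x (f : R) (n k : nat) : (0 < rad c)%N -> 1 <= f ->
  f <= (rad c).+1%:R -> (n <= (rad c).+1 ^ 2)%N -> ball_in c n ->
  reach c [set y | nsq y <= n]%N k x ->
  k%:R <= shape_const * ln f + 1 ->
  1 <= laybound * #|` c|%:R * @lay R d c x.
Proof.
move=> r0 f1 fr nr cn xk kf; set r := rad c in r0 fr nr *.
have w1 := @wbase_ge1 R d d2; have w0 := @wbase_gt0 R d d2.
have b0 := @dexp_gt0 R d d2; have l0 := ln_wbase_gt0.
have [y yn|j jk xj] := @reach_trans _ c _ (core r) k (18 * d) x xk.
  exact: (reach_ball d0 cn).
have h1 : w^-1 ^+ (18 * d).+1 * npow (1 / 2) r.+1%:R <= hitw w c (core r) x.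
  apply: le_trans (hitw_ge w1 xj).
  apply: (@le_trans _ _ (w^-1 ^+ (k + 18 * d)%N)); last first.
    by rewrite ler_wiXn2l ?invr_ge0 ?invf_le1 // ltW.
  rewrite exprSr exprD [leRHS]mulrC -mulrA ler_pM2l ?exprn_gt0 ?invr_gt0 //.
  have -> : w^-1 ^+ k = expR (- (k%:R * ln w)).
    by rewrite expRN expRM_natl lnK // exprVn.
  have -> : w^-1 = expR (- ln w) by rewrite expRN lnK.
  rewrite /npow -expRD ler_expR -opprD lerN2.
  apply: (@le_trans _ _ ((shape_const * ln f + 1) * ln w)).
    by rewrite ler_pM2r.
  have -> : (shape_const * ln f + 1) * ln w = ln w + 1 / 2 * ln f.
    by rewrite /shape_const; field; rewrite gt_eqF.
  rewrite lerD2l ler_pM2l ?divr_gt0 // ler_ln ?posrE ?ltr0n //.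
  exact: lt_le_trans f1.
have h2 : 2 * b * npow (2 * b + 1) r.+1%:R <= @layscale R d r.
  by rewrite ler_pM2l ?mulr_gt0 // npow_nincr; [|lra|lia].
have h3 : 2 * b * (r.+1%:R ^+ d)^-1 * w^-1 ^+ (18 * d).+1 <= @lay R d c x.
  apply: le_trans (ler_pM _ _ h2 h1); last 2 first.
  - by rewrite !mulr_ge0 ?ltW ?npow_gt0.
  - by rewrite mulr_ge0 ?exprn_ge0 ?invr_ge0 ?ltW ?npow_gt0.
  rewrite -npow_nat ?ltr0n // (_ : d%:R = (2 * b + 1) + 1 / 2).
    rewrite npowD; lra.
  by rewrite /dexp; field.
have h4 : r.+1%:R ^+ d <= d%:R ^+ d * #|` c|%:R :> R.
  rewrite -!natrX -natrM ler_nat.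
  apply: (@leq_trans (d ^ d * (r %/ d).+1 ^ d)).
    by rewrite -expnMn leq_exp2r // mulnC ltn_ceil.
  by rewrite leq_mul // ball_in_card //; exact: rad_ball.
have r1 : 0 < r.+1%:R ^+ d :> R by rewrite exprn_gt0 // ltr0n.
apply: le_trans (ler_wpM2l _ h3); last first.
  by rewrite mulr_ge0 ?ler0n // ltW // laybound_gt0.
have -> : laybound * #|` c|%:R * (2 * b * (r.+1%:R ^+ d)^-1 * w^-1 ^+ (18 * d).+1)
    = (d%:R ^+ d * #|` c|%:R) / r.+1%:R ^+ d.
  rewrite /laybound exprVn; field.
  by rewrite !gt_eqF // ?exprn_gt0.
by rewrite ler_pdivlMr // mul1r.
Qed.

Lemma org_ge c x n : reach c [set 0] n x -> w^-1 ^+ #|` c| <= org c x.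
Proof.
move=> /reach_short[k kc xk]; apply: le_trans (hitw_ge (wbase_ge1 d2) xk).
by rewrite ler_wiXn2l ?invr_ge0 ?invf_le1 ?wbase_ge1 ?wbase_gt0 // ltW ?wbase_gt0.
Qed.

(* A bounded total gain would bound the number of edges, since each boundary
   visit multiplies it by at most [exp (M K gain)]; but then [org] stays
   bounded away from [0]. *)
Lemma gain_diverges (c : nat -> {fset site d * site d}) (x : nat -> site d)
    (t0 M : nat) (K S : R) : 0 < K ->
  (forall t, (t0 <= t)%N -> (#|` c t.+1| <= #|` c t| + M)%N) ->
  (forall t, (t0 <= t)%N -> (2 * d <= #|` nbr (c t) (x t)|)%N ->
    #|` c t.+1| = #|` c t|) ->
  (forall t, (t0 <= t)%N -> 1 <= K * #|` c t|%:R * @lay R d (c t) (x t)) ->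
  (forall t, (t0 <= t)%N -> exists n, reach (c t) [set 0] n (x t)) ->
  (forall n, \sum_(t0 <= t < n) @gain R d (c t) (x t) <= S) -> False.
Proof.
move=> K0 cM cE cl cr cS; pose G n := \sum_(t0 <= t < n) @gain R d (c t) (x t).
have cG n : #|` c (t0 + n)%N|%:R <= #|` c t0|%:R * expR (K * M%:R * G (t0 + n)%N) :> R.
  elim: n => [|n IH].
    by rewrite addn0 /G big_geq // mulr0 expR0 mulr1.
  rewrite addnS /G big_nat_recr ?leq_addr //= -/(G _) mulrDr expRD mulrA.
  apply: (@le_trans _ _ (#|` c (t0 + n)%N|%:R *
      expR (K * M%:R * @gain R d (c (t0 + n)%N) (x (t0 + n)%N)))); last first.
    by rewrite ler_wpM2r // expR_ge0.
  have g0 := @gain_ge0 R d d2 (c (t0 + n)%N) (x (t0 + n)%N).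
  have t0n : (t0 <= t0 + n)%N := leq_addr _ _.
  have [nd|nd] := leqP (2 * d) #|` nbr (c (t0 + n)%N) (x (t0 + n)%N)|.
    rewrite cE // ler_peMr // -expR0 ler_expR !mulr_ge0 //; exact: ltW.
  (* At a boundary visit, [1 <= K a l] turns the additive growth [M] into the factor
     [1 + K M gain]. *)
  apply: (@le_trans _ _ (#|` c (t0 + n)%N|%:R + M%:R)).
    by rewrite -natrD ler_nat cM.
  apply: (@le_trans _ _ (#|` c (t0 + n)%N|%:R *
      (1 + K * M%:R * @gain R d (c (t0 + n)%N) (x (t0 + n)%N)))); last first.
    by rewrite ler_wpM2l // expR_ge1Dx.
  rewrite mulrDr mulr1 lerD2l /gain nd.
  have := cl _ t0n; set l := lay _ _; set a := #|` _|%:R => al.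
  have -> : a * (K * M%:R * (org (c (t0 + n)%N) (x (t0 + n)%N) + l)) =
    M%:R * (K * a * l) + M%:R * (K * a * org (c (t0 + n)%N) (x (t0 + n)%N)) by ring.
  rewrite -[leLHS]addr0 lerD //; first by rewrite ler_peMr.
  by rewrite !mulr_ge0 ?org_ge0 // ltW.
pose Q := (Num.truncn (#|` c t0|%:R * expR (K * M%:R * S))).+1.
have cQ n : (#|` c (t0 + n)%N| <= Q)%N.
  rewrite -(ler_nat R); apply: le_trans (cG n) _.
  apply: (@le_trans _ _ (#|` c t0|%:R * expR (K * M%:R * S))).
    by rewrite ler_wpM2l // ler_expR ler_wpM2l ?cS // mulr_ge0 // ltW.
  by rewrite ltW // truncnS_gt.
have w1 := @wbase_ge1 R d d2; have w0 := @wbase_gt0 R d d2.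
have gQ n : w^-1 ^+ Q <= @gain R d (c (t0 + n)%N) (x (t0 + n)%N).
  have [k xk] := cr _ (leq_addr n t0).
  apply: (@le_trans _ _ (org (c (t0 + n)%N) (x (t0 + n)%N))).
    apply: le_trans (org_ge xk).
    by rewrite ler_wiXn2l ?invr_ge0 ?invf_le1 // ltW.
  by rewrite lerDl; case: ifP => // _; exact: lay_ge0.
have GQ n : w^-1 ^+ Q * n%:R <= G (t0 + n)%N.
  elim: n => [|n IH]; first by rewrite mulr0 addn0 /G big_geq.
  rewrite addnS /G big_nat_recr ?leq_addr //= -/(G _) -addn1 natrD mulrDr mulr1.
  exact: lerD.
have q0 : 0 < w^-1 ^+ Q by rewrite exprn_gt0 // invr_gt0.
pose N := (Num.truncn (S / w^-1 ^+ Q)).+1.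
have := le_trans (GQ N) (cS _); apply/negP; rewrite -ltNge.
by rewrite mulrC -ltr_pdivrMr // truncnS_gt.
Qed.

End boundary_gain.

(** * Conditional expectations of discrete variables *)

Section discrete_variables.
Context {T : Type} (G : set_system T).
Hypothesis sG : sigma_algebra setT G.

Lemma sigma_setC A : G A -> G (~` A).
Proof. by case: sG => _ + _ => /[apply]; rewrite setTD. Qed.

Lemma sigma_bigcup (I : countType) (A : I -> set T) :
  (forall i, G (A i)) -> G [set w | exists i, A i w].
Proof.
move=> GA; case: sG => G0 _ GU.
rewrite (_ : [set w | _] = \bigcup_k (oapp A set0 (choice.unpickle k))).
  by apply: GU => k; case: (choice.unpickle k) => /=.
apply/seteqP; split => w /=.
  by move=> [i Ai]; exists (choice.pickle i) => //; rewrite choice.pickleK.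
by move=> [k _]; case: (choice.unpickle k) => //= i Ai; exists i.
Qed.

Lemma sigma_bigcap (I : countType) (A : I -> set T) :
  (forall i, G (A i)) -> G [set w | forall i, A i w].
Proof.
move=> GA; rewrite (_ : [set w | _] = ~` [set w | exists i, (~` A i) w]).
  by apply/sigma_setC/sigma_bigcup => i; exact: sigma_setC.
apply/seteqP; split => w /=; first by move=> Aw [i].
by move=> Aw i; apply: contrapT => Aiw; apply: Aw; exists i.
Qed.

Lemma sigma_setI A B : G A -> G B -> G (A `&` B).
Proof.
move=> GA GB; have := @sigma_bigcap bool (fun b => if b then A else B).
rewrite (_ : [set w | _] = A `&` B); first by apply; case.
apply/seteqP; split => w /=; first by move=> h; have := h true; have := h false.
by move=> [Aw Bw] [].
Qed.

Lemma sigma_cst (Q : Prop) : G [set _ | Q].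
Proof.
case: sG => G0 _ _; have [q|q] := pselect Q.
  rewrite (_ : [set _ | _] = ~` set0); first exact: sigma_setC.
  by apply/seteqP; split => w //= _ [].
by rewrite (_ : [set _ | _] = set0) //; apply/seteqP; split => w.
Qed.

Definition discrete (E : countType) (X : T -> E) : Prop :=
  forall e, G [set w | X w = e].

Lemma discrete_preimage (E : countType) (X : T -> E) (A : set E) :
  discrete X -> G (X @^-1` A).
Proof.
move=> GX; rewrite (_ : X @^-1` A = [set w | exists e, ([set _ | A e] `&` [set w | X w = e]) w]).
  by apply: sigma_bigcup => e; apply: sigma_setI => //; exact: sigma_cst.
apply/seteqP; split => w /=; first by exists (X w).
by move=> [e [Ae ->]].
Qed.

Lemma discrete_pair (E E' : countType) (X : T -> E) (Y : T -> E') :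
  discrete X -> discrete Y -> discrete (fun w => (X w, Y w)).
Proof.
move=> GX GY [e e']; rewrite (_ : [set w | _] = [set w | X w = e] `&` [set w | Y w = e']).
  exact: sigma_setI.
by apply/seteqP; split => w /=; [case=> -> ->|case=> -> ->].
Qed.

End discrete_variables.

(** * One-step inequalities in expectation and almost sure summability *)

Section conditional_step.
Context (R : realType) (disp : measure_display) (T : measurableType disp).
Variable P : probability T R.
Local Open Scope ereal_scope.

Lemma sigma_algebra_measurable : sigma_algebra setT (@measurable disp T).
Proof.
split; first exact: measurable0.
  by move=> A mA; rewrite setTD; exact: measurableC.
by move=> A mA; exact: bigcupT_measurable.
Qed.

Lemma discrete_measurable_fun (E : countType) (X : T -> E) (f : E -> \bar R)
    (D : set T) : measurable D -> discrete (@measurable disp T) X ->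
  measurable_fun D (fun w => f (X w)).
Proof.
move=> mD mX _ B mB; apply: measurableI => //.
exact: (discrete_preimage sigma_algebra_measurable (f @^-1` B) mX).
Qed.

Lemma discrete_integral_le (E : countType) (X : T -> E) (N : set T)
    (f g : T -> \bar R) : measurable N -> discrete (@measurable disp T) X ->
  measurable_fun N f -> measurable_fun N g ->
  (forall w, 0 <= f w) -> (forall w, 0 <= g w) ->
  (forall e, \int[P]_(w in N `&` [set w | X w = e]) f w <=
             \int[P]_(w in N `&` [set w | X w = e]) g w) ->
  \int[P]_(w in N) f w <= \int[P]_(w in N) g w.
Proof.
move=> mN mX mf mg f0 g0 fg.
pose B k := N `&` [set w | choice.pickle (X w) = k].
have mB k : measurable (B k).
  apply: measurableI => //.
  exact: (discrete_preimage sigma_algebra_measurable [set e | choice.pickle e = k] mX).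
have NB : N = \bigcup_k B k.
  apply/seteqP; split => [w Nw|w [k _ []//]]; by exists (choice.pickle (X w)).
have tB : trivIset setT B.
  by move=> i j _ _ [w [[_ <-] [_ <-]]].
have -> : \int[P]_(w in N) f w = \sum_(k <oo) \int[P]_(w in B k) f w.
  by rewrite NB ge0_integral_bigcup -?NB.
have -> : \int[P]_(w in N) g w = \sum_(k <oo) \int[P]_(w in B k) g w.
  by rewrite NB ge0_integral_bigcup -?NB.
apply: lee_nneseries => [k _ _|k _]; first exact: integral_ge0.
have [[w [Nw wk]]|nB] := pselect (exists w, B k w); last first.
  have -> : B k = set0.
    by apply/seteqP; split => w //= Bw; apply: nB; exists w.
  by rewrite !integral_set0.
rewrite (_ : B k = N `&` [set w' | X w' = X w]) //.
rewrite /B; congr (_ `&` _); apply/seteqP; split => w' /=; rewrite -wk.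
  exact: (pcan_inj choice.pickleK).
by move=> ->.
Qed.

(* The almost sure hypothesis says that, given [G], [Y] is uniform on [nb X]. *)
Lemma uniform_step (G : set_system T) (E S : countType) (X : T -> E)
    (Y : T -> S) (q : S -> T -> R) (nb : E -> {fset S}) (N : set T)
    (V : E -> S -> R) (g h : E -> R) :
  sigma_algebra setT G -> G `<=` measurable ->
  discrete G X -> discrete (@measurable disp T) Y -> G N ->
  (forall y, is_cond_prob P G [set w | Y w = y] (q y)) ->
  (forall e y, (0 <= V e y)%R) -> (forall e, 0 <= g e)%R -> (forall e, 0 <= h e)%R ->
  {ae P, forall w, N w -> [/\ Y w \in nb (X w),
    forall y, y \in nb (X w) -> q y w = (#|` nb (X w)|%:R^-1)%R &
    (\sum_(y <- nb (X w)) V (X w) y + g (X w) * #|` nb (X w)|%:R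
      <= h (X w) * #|` nb (X w)|%:R)%R]} ->
  \int[P]_(w in N) (V (X w) (Y w))%:E + \int[P]_(w in N) (g (X w))%:E
    <= \int[P]_(w in N) (h (X w))%:E.
Proof.
move=> sG GM GX mY GN qP V0 g0 h0 ae.
have mN := GM _ GN; have mX : discrete measurable X by move=> e; apply: GM.
have mXY := discrete_pair sigma_algebra_measurable mX mY.
have mV : measurable_fun N (fun w => (V (X w) (Y w))%:E).
  exact: (discrete_measurable_fun (fun p => (V p.1 p.2)%:E) mN mXY).
have mg : measurable_fun N (fun w => (g (X w))%:E).
  exact: (discrete_measurable_fun (fun p => (g p)%:E) mN mX).
have mh : measurable_fun N (fun w => (h (X w))%:E).
  exact: (discrete_measurable_fun (fun p => (h p)%:E) mN mX).
rewrite -ge0_integralD //; try by move=> w _; rewrite lee_fin.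
apply: (discrete_integral_le mN mX) => //.
- exact: emeasurable_funD.
- by move=> w; rewrite -EFinD lee_fin addr_ge0.
- by move=> w; rewrite lee_fin.
move=> e; set B := N `&` _.
have GB : G B by apply: sigma_setI.
have mB := GM _ GB; have BN : B `<=` N by move=> w [].
have [B0|B0] := eqVneq (P B) 0.
  rewrite !null_set_integral //; first exact: measurable_funS mh.
  exact: (measurable_funS mN BN (emeasurable_funD mV mg)).
(* An atom of positive measure contains a point where the almost sure properties hold. As [X] equals
   [e] on the whole atom, the inequality obtained there is a deterministic one about [e]. *)
have [w0 [[Nw0 Xw0] good]] : exists w, B w /\ (N w -> [/\ Y w \in nb (X w),
    forall y, y \in nb (X w) -> q y w = (#|` nb (X w)|%:R^-1)%R &
    (\sum_(y <- nb (X w)) V (X w) y + g (X w) * #|` nb (X w)|%:R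
      <= h (X w) * #|` nb (X w)|%:R)%R]).
  apply: contrapT => nB; case/eqP: B0; apply/negligibleP => //.
  apply: negligibleS ae => w Bw /= good; apply: nB; by exists w.
have {good}[Yn _] := good Nw0; rewrite Xw0 in Yn *; set n := #|` nb e| => ineq.
have n0 : (0 < n%:R :> R)%R by rewrite ltr0n cardfs_gt0; apply/fset0Pn; exists (Y w0).
have Py y : y \in nb e -> P ([set w | Y w = y] `&` B) = (n%:R^-1)%:E * P B.
  move=> ye; rewrite -(cond_probE (qP y) GB) -integral_cst //.
  apply: ae_eq_integral => //.
  - apply: (measurable_funS measurableT) => //.
    by have := cond_prob_integrable (qP y) => /measurable_int.
  - apply: filterS ae => w good [Nw Xw]; have [_ + _] := good Nw.
    by rewrite Xw => /(_ y ye) ->.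
rewrite [leRHS](_ : _ = (h e)%:E * P B); last first.
  rewrite -integral_cst //; apply: eq_integral => w; rewrite inE => -[_ ->//].
(* Almost surely [Y] lies in [nb e], so [V e (Y w)] is one term of the sum of indicators. *)
have Bsum : \int[P]_(w in B) ((V (X w) (Y w))%:E + (g (X w))%:E) <=
    \int[P]_(w in B) (\sum_(y <- nb e) ((V e y)%:E * (\1_[set w | Y w = y] w)%:E) + (g e)%:E).
  apply: ae_ge0_le_integral => //.
  - by move=> w _; rewrite -EFinD lee_fin addr_ge0.
  - exact: (measurable_funS mN BN (emeasurable_funD mV mg)).
  - move=> w _; rewrite adde_ge0 ?lee_fin // sume_ge0 // => y _.
    by rewrite -EFinM lee_fin mulr_ge0.
  - apply: emeasurable_funD => //; apply: emeasurable_sum => y.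
    apply: measurable_funeM; apply/measurable_EFinP/measurable_indic; exact: mY.
  - apply: filterS ae => w good [Nw Xw]; have [+ _ _] := good Nw; rewrite Xw => Yw.
    rewrite leeD2r // (big_fsetD1 (Y w)) //= indicE mem_set // mule1 leeDl //.
    by rewrite sume_ge0 // => y _; rewrite -EFinM lee_fin mulr_ge0.
apply: le_trans Bsum _.
rewrite ge0_integralD //; last 3 first.
- move=> w _; rewrite sume_ge0 // => y _; by rewrite -EFinM lee_fin mulr_ge0.
- apply: emeasurable_sum => y.
  apply: measurable_funeM; apply/measurable_EFinP/measurable_indic; exact: mY.
- by move=> w _; rewrite lee_fin.
rewrite ge0_integral_sum //; last 2 first.
- move=> y; apply: measurable_funeM; apply/measurable_EFinP/measurable_indic; exact: mY.
- by move=> y w _; rewrite -EFinM lee_fin mulr_ge0.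
have -> : \int[P]_(w in B) (g e)%:E = (g e)%:E * P B by exact: integral_cst.
rewrite (eq_big_seq (fun y => (V e y / n%:R)%:E * P B)); last first.
  move=> y ye; rewrite ge0_integralZl_EFin //; last first.
    apply/measurable_EFinP/measurable_indic; exact: mY.
  rewrite (_ : \int[P]_(w in B) _ = P ([set w | Y w = y] `&` B)).
    by rewrite Py // EFinM muleA.
  rewrite integral_indic //; exact: mY.
have PBf : P B \is a fin_num by exact: fin_num_measure.
rewrite -(fineK PBf); under eq_bigr do rewrite -EFinM.
rewrite sumEFin -!EFinM -EFinD lee_fin -mulr_suml -mulrDl ler_wpM2r ?fine_ge0 //.
rewrite -(ler_pM2r n0); apply: le_trans ineq.
rewrite mulrDl lerD2r -mulr_suml divfK // gt_eqF //.
Qed.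

(** Telescoping [step] along the decreasing events bounds the expected partial sums of [b] by [C].
    By monotone convergence the series is integrable on the intersection, hence almost surely finite
    there. *)
Lemma ae_sum_bounded (a b : nat -> T -> R) (N : nat -> set T) (C : R) :
  (forall k, measurable (N k)) -> (forall k, N k.+1 `<=` N k) ->
  (forall k, measurable_fun setT (a k)) -> (forall k, measurable_fun setT (b k)) ->
  (forall k w, 0 <= a k w)%R -> (forall k w, 0 <= b k w)%R ->
  (forall w, a 0%N w <= C)%R ->
  (forall k, \int[P]_(w in N k) (a k.+1 w)%:E + \int[P]_(w in N k) (b k w)%:E
     <= \int[P]_(w in N k) (a k w)%:E) ->
  {ae P, forall w, (forall k, N k w) ->
    exists S : R, forall n, (\sum_(k < n) b k w <= S)%R}.
Proof.
move=> mN NS ma mb a0 b0 aC step.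
have mE (f : T -> R) D : measurable_fun setT f -> measurable_fun D (EFin \o f).
  by move=> mf; apply/measurable_EFinP; apply: measurable_funTS.
have aS n : \int[P]_(w in N n) (a n w)%:E +
    \sum_(0 <= k < n) \int[P]_(w in N k) (b k w)%:E <= C%:E.
  elim: n => [|n IH].
    rewrite big_geq // adde0; apply: (@le_trans _ _ (\int[P]_(w in N 0%N) C%:E)).
      apply: ge0_le_integral => //; [|exact: mE|by move=> w _; rewrite lee_fin].
      by move=> w _; rewrite lee_fin.
    rewrite integral_cst // -[leRHS]mule1 lee_pmul //; last exact: probability_le1.
    by rewrite lee_fin (le_trans (a0 0%N point)).
  apply: le_trans IH; rewrite big_nat_recr //= [X in _ + X]addeC addeA.
  apply: leeD => //; apply: le_trans (step n); apply: leeD => //.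
  by apply: ge0_subset_integral => //; [exact: mE|move=> w _; rewrite lee_fin].
pose Ni := \bigcap_k N k.
have mNi : measurable Ni by exact: bigcapT_measurable.
have bS : \int[P]_(w in Ni) (\sum_(k <oo) (b k w)%:E) <= C%:E.
  rewrite integral_nneseries //; last 2 first.
  - by move=> k; exact: mE.
  - by move=> k w _; rewrite lee_fin.
  apply: lime_le.
    apply: is_cvg_nneseries => k _ _; apply: integral_ge0 => w _.
    by rewrite lee_fin.
  apply: nearW => n; apply: le_trans (aS n).
  apply: (@le_trans _ _ (\sum_(0 <= k < n) \int[P]_(w in N k) (b k w)%:E)).
    apply: lee_sum => k _; apply: ge0_subset_integral => //; first exact: mE.
      by move=> w _; rewrite lee_fin.
    by move=> w; apply.
  by rewrite leeDr // integral_ge0 // => w _; rewrite lee_fin.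
have iS : P.-integrable Ni (fun w => \sum_(k <oo) (b k w)%:E).
  apply/integrableP; split.
    apply: ge0_emeasurable_sum => [k w _ _|k _]; first by rewrite lee_fin.
    exact: mE.
  rewrite (eq_integral (fun w => \sum_(k <oo) (b k w)%:E)).
    by apply: le_lt_trans bS _; exact: ltry.
  move=> w _; rewrite gee0_abs // nneseries_ge0 // => k _ _; by rewrite lee_fin.
have := integrable_ae mNi iS; apply: filterS => w fin Nw.
have {}fin := fin (fun k _ => Nw k).
exists (fine (\sum_(k <oo) (b k w)%:E)) => n.
rewrite -lee_fin (fineK fin) -sumEFin -(big_mkord xpredT (fun k => (b k w)%:E)).
by apply: nneseries_lim_ge => k _ _; rewrite lee_fin.
Qed.

End conditional_step.

(** * Edge sets of domains *)

Section edge_codes.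
Context {d : nat}.
Implicit Types (G H : zgraph d) (x y : site d).

Definition ordered_edges G : set (site d * site d) := [set p | edge G p.1 p.2].

(* Junk value: [code G = fset0] when [G] has infinitely many edges. *)
Definition code G : {fset site d * site d} := fset_set (ordered_edges G).

Lemma code_arc G x y : finite_set (ordered_edges G) -> arc (code G) x y = edge G x y.
Proof. by move=> fG; rewrite /arc /code in_fset_set //; apply/idP/idP; rewrite inE. Qed.

Lemma code_finite G : code G != fset0 -> finite_set (ordered_edges G).
Proof. by rewrite /code /fset_set; case: pselect => //; rewrite eqxx. Qed.

Lemma code_zd G : zd_graph (code G).
Proof.
have [fG|fG] := pselect (finite_set (ordered_edges G)).
  by split=> x y; rewrite !code_arc //; [exact: edge_zd_adj|exact: edge_sym].
have -> : code G = fset0 by rewrite /code /fset_set; case: pselect.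
by split => x y; rewrite /arc inE.
Qed.

Lemma code_sub G H : finite_set (ordered_edges H) -> subgraph G H ->
  (code G `<=` code H)%fset.
Proof.
move=> fH [_ GH]; apply/fsubsetP => -[x y].
have fG : finite_set (ordered_edges G) by apply: sub_finite_set fH => p /=; exact: GH.
by rewrite -!/(arc _ x y) !code_arc //; exact: GH.
Qed.

Lemma degree_code G x : finite_set (ordered_edges G) ->
  degree G x = #|` nbr (code G) x|.
Proof.
move=> fG; have fx : finite_set [set y | edge G x y].
  apply: sub_finite_set (finite_image snd fG) => y /= xy.
  by exists (x, y).
rewrite /degree; congr #|` _|; apply/fsetP => y.
by rewrite in_fset_set // in_nbr code_arc //; apply/idP/idP; rewrite inE.
Qed.

(** A nonempty code determines every edge, which gives a countable intersection of events of [F].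
    The value [fset0], shared by edgeless and infinite graphs, is the complement of all the
    others. *)
Lemma code_discrete (disp : measure_display) (T : measurableType disp)
    (F : set_system T) (D : T -> zgraph d) :
  sigma_algebra setT F -> graph_measurable F D -> discrete F (fun w => code (D w)).
Proof.
move=> sF [_ FD].
have FE (c : {fset site d * site d}) :
    F [set w | forall p, edge (D w) p.1 p.2 = (p \in c)].
  apply: sigma_bigcap => // p; case: (p \in c); first exact: FD.
  rewrite (_ : (fun w => _) = ~` [set w | edge (D w) p.1 p.2]).
    by apply: sigma_setC => //; exact: FD.
  by apply/seteqP; split => w /=; [move=> ->|move/negP/negbTE].
have ne (c : {fset site d * site d}) : c != fset0 ->
    [set w | code (D w) = c] = [set w | forall p, edge (D w) p.1 p.2 = (p \in c)].
  move=> c0; apply/seteqP; split => w /=.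
    move=> cE [x y]; rewrite -cE -/(arc _ x y) code_arc //.
    by apply: code_finite; rewrite cE.
  move=> h; have fD : finite_set (ordered_edges (D w)).
    rewrite (_ : ordered_edges _ = [set` c]) //.
    by apply/seteqP; split => p /=; rewrite /ordered_edges /= h.
  by apply/fsetP => p; rewrite -h /code in_fset_set //; apply/idP/idP; rewrite inE.
move=> c; have [->|c0] := eqVneq c fset0; last by rewrite ne.
rewrite (_ : [set w | _] = ~` [set w | exists c : {fset site d * site d},
    ([set _ | c != fset0] `&` [set w | forall p, edge (D w) p.1 p.2 = (p \in c)]) w]).
  apply: sigma_setC => //; apply: sigma_bigcup => // c'.
  by apply: sigma_setI => //; exact: sigma_cst.
apply/seteqP; split => w /=.
  move=> c0 [c' [c'0]] h; move: (c'0); have := ne _ c'0; move/seteqP => [_ /(_ w h) /=].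
  by rewrite c0 => <-; rewrite eqxx.
move=> h; apply: contrapT => /eqP c0; apply: h; exists (code (D w)); split => //.
by have := ne _ c0; move/seteqP => [/(_ w) /= + _]; exact.
Qed.

Section added_edges.
Variables (G H : zgraph d).

(** An arbitrary orientation of an undirected edge; [rep] and its swap give the two arcs, whence the
    factor [2] in [card_code_added]. *)
Let rep (e : set (site d)) : site d * site d :=
  xget (0, 0) [set p : site d * site d | e = [set p.1; p.2]].

Let swap (p : site d * site d) := (p.2, p.1).

Let added p : ordered_edges H p -> ~ ordered_edges G p ->
  (edges H `\` edges G) [set p.1; p.2].
Proof.
case: p => x y /= Hxy nG; split; first by exists x, y.
move=> [x' [y' [Gxy' e]]]; apply: nG; rewrite /ordered_edges /=.
have : [set x'; y'] x by rewrite -e; left.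
have : [set x'; y'] y by rewrite -e; right.
have : [set x; y] x' by rewrite e; left.
have : [set x; y] y' by rewrite e; right.
by move=> /= [] e1 [] e2 [] e3 [] e4; subst;
  first [exact: Gxy' | exact: edge_sym Gxy'].
Qed.

Let rep_or p e : e = [set p.1; p.2] -> p = rep e \/ p = swap (rep e).
Proof.
move=> eE; have : e = [set (rep e).1; (rep e).2].
  rewrite /rep; apply: (@xgetPex _ (0, 0)
    [set p : site d * site d | e = [set p.1; p.2]]).
  by exists p.
case: p eE => x y /= eE; case: (rep e) => x' y' /= eE'; rewrite /swap /=.
have : [set x'; y'] x by rewrite -eE' eE; left.
have : [set x'; y'] y by rewrite -eE' eE; right.
have : [set x; y] x' by rewrite -eE eE'; left.
have : [set x; y] y' by rewrite -eE eE'; right.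
by move=> /= [] e1 [] e2 [] e3 [] e4; subst; auto.
Qed.

Lemma finite_added : finite_set (ordered_edges G) ->
  finite_set (edges H `\` edges G) -> finite_set (ordered_edges H).
Proof.
move=> fG fE.
apply: (@sub_finite_set _ _ (ordered_edges G `|` (rep @` (edges H `\` edges G) `|`
    (swap \o rep) @` (edges H `\` edges G)))); last first.
  by rewrite !finite_setU; split => //; split; exact: finite_image.
move=> p Hp; have [Gp|nGp] := pselect (ordered_edges G p); [by left|right].
have Ep := added Hp nGp.
by have [pE|pE] := rep_or (erefl [set p.1; p.2]); [left|right];
  exists [set p.1; p.2].
Qed.

Lemma card_code_added (M : nat) : finite_set (ordered_edges G) ->
  (edges H `\` edges G #<= `I_M)%card -> (#|` code H| <= #|` code G| + 2 * M)%N.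
Proof.
move=> fG EM; have fE : finite_set (edges H `\` edges G) by apply/finite_set_leP; exists M.
have fH := finite_added fG fE.
set E := fset_set (edges H `\` edges G).
have ME : (#|` E| <= M)%N.
  have [n En] := fE; rewrite /E (card_fset_set En) -card_le_II.
  by rewrite -(card_le_eql En).
have sub : (code H `<=` code G `|` ([fset rep e | e in E] `|` [fset swap (rep e) | e in E]))%fset.
  apply/fsubsetP => p; rewrite /code in_fset_set // inE => Hp; rewrite !inE.
  have [Gp|nGp] := pselect (ordered_edges G p).
    by rewrite in_fset_set // mem_set.
  apply/orP; right.
  have Ep : [set p.1; p.2] \in E by rewrite /E in_fset_set // inE; exact: added.
  have [pE|pE] := rep_or (erefl [set p.1; p.2]); apply/orP; [left|right].
    by apply/imfsetP; exists [set p.1; p.2].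
  by apply/imfsetP; exists [set p.1; p.2].
apply: leq_trans (fsubset_leq_card sub) _.
have cU (A B : {fset site d * site d}) : (#|` (A `|` B)%fset| <= #|` A| + #|` B|)%N.
  by rewrite cardfsU leq_subr.
apply: leq_trans (cU _ _) _; rewrite leq_add2l.
apply: leq_trans (cU _ _) _; rewrite mul2n -addnn leq_add //.
  exact: leq_trans (leq_imfset_card _ _ _) _.
exact: leq_trans (leq_imfset_card _ _ _) _.
Qed.

End added_edges.

End edge_codes.

(** * Layer bounds for domains that are almost a ball *)

Section shape.
Context {R : realType} {d : nat}.
Implicit Types (z : site d) (f : R).

Lemma mem_lattice_ball f z : 0 < f ->
  lattice_points f (@unit_eball R d) z <-> (nsq z)%:R <= f ^+ 2.
Proof.
move=> f0; rewrite (nsqE R); split.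
  move=> [x x1 /rowP xz]; rewrite /unit_eball /= /enorm in x1.
  have {}x1 : \sum_(i < d) x 0 i ^+ 2 <= 1.
    by move: x1; rewrite -[leRHS]sqrtr1 ler_psqrt // ?nnegrE ?sumr_ge0 // => i _; exact: sqr_ge0.
  rewrite (eq_bigr (fun i => f ^+ 2 * x 0 i ^+ 2)) => [|i _].
    by rewrite -mulr_sumr ler_piMr // exprn_ge0 // ltW.
  by have := xz i; rewrite !mxE => <-; rewrite exprMn.
move=> zf; exists (f^-1 *: map_mx intr z); last by rewrite scalerA divff ?scale1r // gt_eqF.
rewrite /unit_eball /= /enorm -[leRHS]sqrtr1 ler_wsqrtr //.
rewrite (eq_bigr (fun i => (f ^+ 2)^-1 * (z 0 i)%:~R ^+ 2)) => [|i _].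
  by rewrite -mulr_sumr mulrC ler_pdivrMr ?exprn_gt0 // mul1r.
by rewrite !mxE exprMn exprVn.
Qed.

Lemma shape_lay_ge (G : zgraph d) f z : (2 <= d)%N ->
  finite_set (ordered_edges G) -> 1 <= f ->
  subgraph (induced_graph (lattice_points f (@unit_eball R d))) G ->
  (graph_dist R G z (lattice_points f (@unit_eball R d))
     <= (@shape_const R d * ln f)%:E)%E ->
  1 <= @laybound R d * #|` code G|%:R * lay (code G) z.
Proof.
move=> d2 fG f1 [_ fs] dist; have d0 : (0 < d)%N by exact: ltn_trans d2.
have f0 : 0 < f by exact: lt_le_trans f1.
have ball_f n : n%:R <= f ^+ 2 -> ball_in (code G) n.
  move=> nf x y xn yn xy; rewrite code_arc //; apply: fs; rewrite /= xy andbT.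
  apply/andP; split; apply/mem_set/mem_lattice_ball => //;
    by rewrite (le_trans _ nf) // ler_nat.
have f20 : 0 <= f ^+ 2 by rewrite exprn_ge0 // ltW.
have tr : (Num.truncn f)%:R <= f by rewrite truncn_le ltW.
have rt : (Num.truncn f <= rad (code G))%N.
  by apply: le_rad => //; apply: ball_f; rewrite natrX lerXn2r ?nnegrE // ltW.
have fr : f <= (rad (code G)).+1%:R.
  by rewrite ltW // (lt_le_trans (truncnS_gt f)) // ler_nat.
(* The distance is an infimum, so one spare step is allowed in order to extract an actual path from
   a strict inequality. *)
have [_ [p [zp Bp] <-]] : exists2 y, [set ((size p)%:R)%:E | p in
    [set p | path (edge G) z p /\ lattice_points f (@unit_eball R d) (last z p)]] y &
    (y < (@shape_const R d * ln f + 1)%:E)%E.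
  by apply: ereal_inf_lt; apply: le_lt_trans dist _; rewrite lte_fin ltrDl.
rewrite lte_fin => pk.
apply: (@lay_ge R d d2 (code G) z f (Num.truncn (f ^+ 2)) (size p)) => //.
- by apply: leq_trans rt; rewrite truncn_gt0.
- rewrite -(ler_nat R) (le_trans (_ : _ <= f ^+ 2)) ?truncn_le //.
  by rewrite natrX lerXn2r ?nnegrE // ltW.
- by apply: ball_f; rewrite truncn_le.
- exists p; split => //.
    by apply: sub_path zp => x y; rewrite code_arc.
  by rewrite /= truncn_ge_nat //; apply/mem_lattice_ball.
- exact: ltW.
Qed.

End shape.

(** * Recurrence *)

Section walk.
Context {R : realType} {d : nat} (disp : measure_display) (T : measurableType disp).
Context (P : probability T R) (F : nat -> set_system T).
Context (D : nat -> T -> zgraph d) (W : nat -> T -> site d).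
Hypothesis d2 : (2 <= d)%N.
Hypothesis hF : filtration F.
Hypothesis hW : simple_random_walk P F D W.

Let sF t : sigma_algebra setT (F t). Proof. exact: (filtration_sigma hF). Qed.

Let mF t : F t `<=` measurable. Proof. by move=> A; exact: (filtration_meas hF). Qed.

Let cD w t := code (D t w).

Lemma domain_measurable t : graph_measurable (F t) (D t).
Proof.
have [h0 hS] := srw_previsible hW; case: t => // t.
have [hv he] := hS t.
have FF : F t `<=` F t.+1 by exact: (filtration_mono hF).
by split => [x|x y]; apply: FF.
Qed.

Lemma domain_succ_measurable t : graph_measurable (F t) (D t.+1).
Proof. by have [_] := srw_previsible hW; exact. Qed.

Lemma walk_discrete t : discrete (F t) (W t).
Proof. by move=> x; exact: (srw_adapted hW). Qed.

(** For each site [y], the conditional probability of stepping to [y] vanishes on the event that [y]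
    is not a neighbour; there are countably many [y]. *)
Lemma ae_walk_edge : {ae P, forall w, forall t, edge (D t w) (W t w) (W t.+1 w)}.
Proof.
apply: ae_foralln => t.
have [_ hE] := domain_measurable t.
pose B y := [set w | ~~ edge (D t w) (W t w) y].
have FB y : F t (B y).
  rewrite (_ : B y = ~` [set w | exists x, ([set w | W t w = x] `&`
      [set w | edge (D t w) x y]) w]).
    apply: (sigma_setC (sF t)); apply: (sigma_bigcup (sF t)) => x.
    by apply: (sigma_setI (sF t)) => //; exact: walk_discrete.
  apply/seteqP; split => w /=; rewrite /B /=.
    by move=> /negP nE [x [<-]].
  by move=> h; apply/negP => E; apply: h; exists (W t w).
have PB y : P ([set w | W t.+1 w = y] `&` B y) = 0.
  rewrite -(cond_probE (srw_step hW t y) (FB y)) integral0_eq // => w.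
  by rewrite /B /= => /negbTE ->; rewrite mul0r.
apply: (@negligibleS _ _ _ _ (\bigcup_k oapp (fun y => [set w | W t.+1 w = y] `&` B y)
    set0 (choice.unpickle k))).
  move=> w /= /negP nE; exists (choice.pickle (W t.+1 w)) => //.
  by rewrite choice.pickleK.
apply: negligible_bigcup => k; case: (choice.unpickle k) => [y|] /=; last exact: negligible_set0.
have mB : measurable ([set w | W t.+1 w = y] `&` B y).
  by apply: measurableI; [exact: (mF (@walk_discrete t.+1 y))|exact: mF (FB y)].
by apply/(negligibleP _ mB); exact: PB.
Qed.

Hypothesis hG : growing_domains P D.
Hypothesis h0 : {ae P, forall w, contains_star0 (D 0%N w)}.
Hypothesis hfin : {ae P, forall w, finite_set [set x | vert (D 0%N w) x]}.
Hypothesis hR : robt P D W.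

Lemma ae_domain_finite :
  {ae P, forall w, forall t, finite_set (ordered_edges (D t w))}.
Proof.
have [M hM] := hR; apply: filterS2 hfin hM => w fD hMw.
elim=> [|t IH].
  apply: (@sub_finite_set _ _ ([set x | vert (D 0%N w) x] `*` [set x | vert (D 0%N w) x])).
    by move=> [x y] /= xy; split; [exact: edge_vert xy|exact: edge_vert (edge_sym xy)].
  exact: finite_setX.
have [_ cE] := hMw t; apply: finite_added IH _.
by apply/finite_set_leP; exists M.
Qed.

Lemma ae_walk_vert : {ae P, forall w, forall t,
  vert (D t w) (W t w) /\ vert (D t w) 0}.
Proof.
have hS := srw_start hW; apply: filterS3 (filterI hS h0) hG ae_walk_edge => w.
move=> [W0 [v0 _]] hGw hE; elim=> [|t [IH1 IH2]]; first by rewrite W0.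
have [_ [vs _]] := hGw t; split; apply: vs => //.
exact: edge_vert (edge_sym (hE t)).
Qed.

Definition avoid t0 k : set T := [set w | forall j, (j <= k)%N -> W (t0 + j)%N w <> 0].

Lemma avoid_measurable t0 k : F (t0 + k)%N (avoid t0 k).
Proof.
rewrite (_ : avoid t0 k = [set w | forall j, ([set w | (j <= k)%N -> W (t0 + j)%N w <> 0]) w]) //.
apply: (sigma_bigcap (sF _)) => j; have [jk|jk] := leqP j k; last first.
  rewrite (_ : [set w | _] = [set _ | True]); first exact: sigma_cst (sF _) _.
  by apply/seteqP; split => w //=; rewrite leqNgt jk.
rewrite (_ : [set w | _] = ~` [set w | W (t0 + j)%N w = 0]).
  apply: (sigma_setC (sF _)); have jk' : (t0 + j <= t0 + k)%N by rewrite leq_add2l.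
  by apply: (filtration_mono hF jk'); exact: walk_discrete.
by apply/seteqP; split => w //= h; exact: h.
Qed.

(** By previsibility the domain at time [t.+1] is already part of the state known at time [t], so
    only the new position is averaged in [uniform_step]. *)
Lemma energy_ae_step t (N : set T) : F t N -> (forall w, N w -> W t w <> 0) ->
  (\int[P]_(w in N) (@energy R d (cD w t.+1) (W t.+1 w))%:E +
   \int[P]_(w in N) (@gain R d (cD w t) (W t w))%:E <=
   \int[P]_(w in N) (@energy R d (cD w t) (W t w))%:E)%E.
Proof.
move=> FN N0.
have dX : discrete (F t) (fun w => ((cD w t, cD w t.+1), W t w)).
  apply: (discrete_pair (sF t)); last exact: walk_discrete.
  apply: (discrete_pair (sF t)); apply: (code_discrete (sF t)).
    exact: domain_measurable.
  exact: domain_succ_measurable.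
have dY : discrete measurable (W t.+1) by move=> y; exact: (mF (@walk_discrete t.+1 y)).
apply: (@uniform_step R disp T P (F t) _ _ _ (W t.+1) _ (fun e => nbr e.1.1 e.2) N
  (fun e y => energy e.1.2 y) (fun e => gain e.1.1 e.2)
  (fun e => energy e.1.1 e.2) (sF t) (@mF t) dX dY FN (srw_step hW t)) => /=.
- by move=> e y; exact: energy_ge0.
- by move=> e; exact: gain_ge0.
- by move=> e; exact: energy_ge0.
apply: filterS3 ae_walk_edge ae_domain_finite hG => w hE hf hGw Nw.
split.
- by rewrite in_nbr /cD code_arc.
- move=> y; rewrite in_nbr /cD code_arc // => ->.
  by rewrite degree_code // mul1r.
- apply: energy_step => //; last by apply/eqP; exact: N0.
    by apply: code_sub => //; have [] := hGw t.
  exact: code_zd.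
Qed.

Lemma ae_gain_bounded t0 : {ae P, forall w,
  (forall j, W (t0 + j)%N w <> 0) -> exists S : R, forall n,
    \sum_(k < n) @gain R d (cD w (t0 + k)%N) (W (t0 + k)%N w) <= S}.
Proof.
have mX (f : {fset site d * site d} -> site d -> R) t :
    measurable_fun setT (fun w => f (cD w t) (W t w)).
  have dX : discrete measurable (fun w => (cD w t, W t w)).
    move=> e; apply: (@mF t); apply: (discrete_pair (sF t)); last exact: walk_discrete.
    by apply: (code_discrete (sF t)); exact: domain_measurable.
  apply/measurable_EFinP.
  exact: (discrete_measurable_fun (fun p => (f p.1 p.2)%:E) measurableT dX).
have := @ae_sum_bounded R disp T P
  (fun k w => @energy R d (cD w (t0 + k)%N) (W (t0 + k)%N w))
  (fun k w => @gain R d (cD w (t0 + k)%N) (W (t0 + k)%N w)) (avoid t0)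
  (2 + @orgscale R d + @layscale R d 0).
move=> /(_ (fun k => mF (avoid_measurable t0 k))) h.
have {h} := h _ (fun k => mX _ _) (fun k => mX _ _)
  (fun k w => energy_ge0 d2 _ _) (fun k w => gain_ge0 d2 _ _) (fun w => energy_le d2 _ _).
move=> h; have {h} : {ae P, forall w, (forall k, avoid t0 k w) -> exists S : R,
    forall n, \sum_(k < n) @gain R d (cD w (t0 + k)%N) (W (t0 + k)%N w) <= S}.
  apply: h => [k w h j jk|k].
    by apply: h; exact: leqW.
  rewrite addnS; apply: energy_ae_step; first exact: avoid_measurable.
  by move=> w; apply.
by apply: filterS => w h Nw; apply: h => k j _.
Qed.

Hypothesis hS : almost_regular_shape P (@shape_const R d) (@unit_eball R d) D.

Lemma ae_recurrent : {ae P, forall w, recurrent 0 (fun t => W t w)}.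
Proof.
have [M hM] := hR.
(* The time of the last visit to [0] is random, so the gain must be bounded for all starting times
   simultaneously. *)
have hA := ae_foralln ae_gain_bounded.
apply: filterS3 (filterI ae_domain_finite ae_walk_vert) (filterI hG hA)
  (filterI hM hS) => w [hf hv] [hGw hAw] [hMw [f [_ f1 [T0 _ hT0]]]] fin.
(* [fin] says that the visits to [0] are finitely many; [t1] is taken past the last one. *)
have [t1 ht1] : exists t1, forall t, (t1 <= t)%N -> W t w <> 0.
  pose A := [set t | W t w = 0]; exists (\max_(t <- fset_set A) t)%N.+1 => t tm Wt.
  move: tm; rewrite ltnNge => /negP; apply.
  by apply: (leq_bigmax_seq (F := fun t : nat => t) t) => //; rewrite in_fset_set // inE.
pose t0 := maxn T0 t1.
have [j|S hSw] := hAw t0; first by apply: ht1; rewrite (leq_trans (leq_maxr T0 t1)) ?leq_addr.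
(* Each added edge contributes two arcs to the code, hence [2 * M]. *)
apply: (@gain_diverges R d d2 (cD w) (fun t => W t w) t0 (2 * M) (@laybound R d) S).
- exact: laybound_gt0.
- by move=> t _; have [_ cE] := hMw t; exact: card_code_added cE.
- move=> t _ nb; have [DE _] := hMw t; rewrite /cD DE // => -[_].
  by rewrite degree_code // ltnNge nb.
- move=> t tt; have [|fs fd] := hT0 t; first by rewrite /= (leq_trans (leq_maxl T0 t1)).
  have [vW _] := hv t.
  by apply: (shape_lay_ge d2 (hf t) (f1 t) fs); exact: fd.
- move=> t _; have [vW v0] := hv t; have [cG _] := hGw t.
  have [p Wp p0] := cG _ _ vW v0; exists (size p); exists p; split => //.
  by apply: sub_path Wp => x y; rewrite /cD code_arc.
- move=> n; have [nt|nt] := leqP n t0.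
    by rewrite big_geq //; have := hSw 0%N; rewrite big_ord0.
  by rewrite -{1}(add0n t0) big_addn big_mkord; under eq_bigr do rewrite addnC; exact: hSw.
Qed.

End walk.

Theorem proposition1p15 (R : realType) (d : nat) (hd : (2 <= d)%N) :
  exists2 c : R, 0 < c &
    forall (disp : measure_display) (T : measurableType disp)
      (P : probability T R) (F : nat -> set_system T)
      (D : nat -> T -> zgraph d) (W : nat -> T -> site d),
    filtration F ->
    growing_domains P D ->
    {ae P, forall w, contains_star0 (D 0%N w)} ->
    {ae P, forall w, finite_set [set x | vert (D 0%N w) x]} ->
    almost_regular_shape P c (@unit_eball R d) D ->
    simple_random_walk P F D W ->
    robt P D W ->
    {ae P, forall w, recurrent 0 (fun t => W t w)}.
Proof.
exists (@shape_const R d).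
  by rewrite invr_gt0 mulr_gt0 // ln_wbase_gt0.
move=> disp T P F D W hF hG h0 hfin hS hW hR.
exact: (ae_recurrent hd hF hW hG h0 hfin hR hS).
Qed.
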